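(* Let $R$ be a commutative Noetherian ring and let $\mathcal C$ be a subcategory of $\mathrm{mod}\,R$. Suppose that: (1) $\mathcal C$ is a resolving subcategory of $\mathrm{mod}\,R$; (2) $\mathcal C\subseteq\mathcal H$; (3) the syzygy functor $\Omega:\underline{\mathcal C}\to\underline{\mathcal C}$ yields a surjective map on the set of isomorphism classes of objects of $\underline{\mathcal C}$. Then $\mathrm{mod}\,\underline{\mathcal C}$ is a Frobenius category. In particular, $\mathrm{mod}\,\underline{\mathcal G}$ is a Frobenius category.
   Context: $\mathrm{mod}\,R$ is the category of finitely generated $R$-modules. A *subcategory* of $\mathrm{mod}\,R$ always means a full subcategory closed under isomorphism, such that for all $X,Y\in\mathrm{mod}\,R$ one has $X\oplus Y\in\mathcal C$ if and only if $X\in\mathcal C$ and $Y\in\mathcal C$, and which contains all projective modules in $\mathrm{mod}\,R$. $\mathcal C$ is *closed under kernels of epimorphisms* if for every exact sequence $0\to X\to Y\to Z\to 0$ in $\mathrm{mod}\,R$ with $Y,Z\in\mathcal C$ one has $X\in\mathcal C$; it is *extension-closed* if for every such sequence with $X,Z\in\mathcal C$ one has $Y\in\mathcal C$; it is *resolving* if it is both. The transpose $\mathrm{Tr}\,X$ of $X\in\mathrm{mod}\,R$ is the cokernel of $\mathrm{Hom}_R(P_0,R)\to\mathrm{Hom}_R(P_1,R)$, where $P_1\to P_0\to X\to 0$ is a presentation by finitely generated projective modules (unique up to projective summands). $\mathcal H$ is the subcategory of all $X\in\mathrm{mod}\,R$ with $\mathrm{Ext}^i_R(X,R)=0$ for all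 $i>0$. $\mathcal G$ is the subcategory of all $X\in\mathrm{mod}\,R$ with $\mathrm{Ext}^i_R(X,R)=0$ and $\mathrm{Ext}^i_R(\mathrm{Tr}\,X,R)=0$ for all $i>0$ (modules of G-dimension zero). The stable category $\underline{\mathcal C}$ has the same objects as $\mathcal C$, and its morphism sets are $\underline{\mathrm{Hom}}_R(X,Y)=\mathrm{Hom}_R(X,Y)/P(X,Y)$, where $P(X,Y)$ is the submodule of homomorphisms that factor through projective modules. The syzygy $\Omega X$ of $X$ is defined by an exact sequence $0\to\Omega X\to P_0\to X\to 0$ with $P_0$ finitely generated projective; it is unique up to projective summands and defines a functor on stable categories, which maps $\underline{\mathcal C}$ to $\underline{\mathcal C}$ when $\mathcal C$ is resolving. $\mathrm{mod}\,\underline{\mathcal C}$ is the category of finitely presented contravariant additive functors $F$ from $\underline{\mathcal C}$ to abelian groups, with natural transformations as morphisms; finitely presented means that there is an exact sequence $\underline{\mathrm{Hom}}_R(-,X_1)|_{\underline{\mathcal C}}\to\underline{\mathrm{Hom}}_R(-,X_0)|_{\underline{\mathcal C}}\to F\to 0$ with $X_0,X_1\in\mathcal C$. A category is *Frobenius* if it is an abelian category with enough projectives and enough injectives, all projective objects are injective, and all injective objects are projective. *)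

(* Defs.v *)
From HB Require Import structures.
From mathcomp Require Import all_boot all_algebra.
From mathcomp Require Import ring_quotient boolp.

Set Implicit Arguments.
Unset Strict Implicit.
Unset Printing Implicit Defensive.

Import GRing.Theory.
Local Open Scope ring_scope.
Local Open Scope quotient_scope.

#[local] Obligation Tactic := idtac.

Record category := Category {
  obj :> Type;
  hom : obj -> obj -> Type;
  idm : forall X, hom X X;
  comp : forall X Y Z, hom Y Z -> hom X Y -> hom X Z;
  comp_idl : forall X Y (f : hom X Y), comp (idm Y) f = f;
  comp_idr : forall X Y (f : hom X Y), comp f (idm X) = f;
  comp_assoc : forall W X Y Z (h : hom Y Z) (g : hom X Y) (f : hom W X),
    comp h (comp g f) = comp (comp h g) f }.

Arguments comp {c X Y Z}.

Section CategoryNotions.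
Variable K : category.
Implicit Types X Y Z : K.

Definition isomorphic X Y : Prop :=
  exists (f : hom X Y) (g : hom Y X), comp g f = idm X /\ comp f g = idm Y.

Definition mono X Y (m : hom X Y) : Prop :=
  forall W (f g : hom W X), comp m f = comp m g -> f = g.

Definition epi X Y (e : hom X Y) : Prop :=
  forall W (f g : hom Y W), comp f e = comp g e -> f = g.

Definition zero_object Z : Prop :=
  (forall X, exists! f : hom X Z, True) /\
  (forall X, exists! f : hom Z X, True).

Definition zero_morphism X Y (f : hom X Y) : Prop :=
  exists Z (g : hom Z Y) (h : hom X Z), zero_object Z /\ f = comp g h.

Definition is_product X Y P (p : hom P X) (q : hom P Y) : Prop :=
  forall W (f : hom W X) (g : hom W Y),
    exists! h : hom W P, comp p h = f /\ comp q h = g.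

Definition is_coproduct X Y S (i : hom X S) (j : hom Y S) : Prop :=
  forall W (f : hom X W) (g : hom Y W),
    exists! h : hom S W, comp h i = f /\ comp h j = g.

Definition is_kernel X Y (f : hom X Y) N (k : hom N X) : Prop :=
  zero_morphism (comp f k) /\
  forall W (h : hom W X), zero_morphism (comp f h) ->
    exists! u : hom W N, comp k u = h.

Definition is_cokernel X Y (f : hom X Y) Q (c : hom Y Q) : Prop :=
  zero_morphism (comp c f) /\
  forall W (h : hom Y W), zero_morphism (comp h f) ->
    exists! u : hom Q W, comp u c = h.

(* Freyd's axioms: they speak of a bare category, on which they determine the
   additive structure. The natural transformations between functors on mod R
   form a type too large to carry a zmodType, so functor categories are not
   instances of preadditive below. *)
Definition abelian : Prop :=
  [/\ exists Z, zero_object Z,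
      (forall X Y, exists P (p : hom P X) (q : hom P Y), is_product p q) /\
      (forall X Y, exists S (i : hom X S) (j : hom Y S), is_coproduct i j),
      (forall X Y (f : hom X Y), exists N (k : hom N X), is_kernel f k) /\
      (forall X Y (f : hom X Y), exists Q (c : hom Y Q), is_cokernel f c),
      forall X Y (m : hom X Y), mono m ->
        exists Z (f : hom Y Z), is_kernel f m
    & forall X Y (e : hom X Y), epi e ->
        exists Z (f : hom Z X), is_cokernel f e].

Definition projective_object P : Prop :=
  forall X Y (e : hom X Y) (f : hom P Y), epi e -> exists g, comp e g = f.

Definition injective_object I : Prop :=
  forall X Y (m : hom X Y) (f : hom X I), mono m -> exists g, comp g m = f.

Definition enough_projectives : Prop :=
  forall X, exists P (e : hom P X), projective_object P /\ epi e.

Definition enough_injectives : Prop :=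
  forall X, exists I (m : hom X I), injective_object I /\ mono m.

Definition frobenius : Prop :=
  [/\ abelian, enough_projectives, enough_injectives,
      forall P, projective_object P -> injective_object P
    & forall I, injective_object I -> projective_object I].

End CategoryNotions.

Record preadditive := Preadditive {
  pobj :> Type;
  phom : pobj -> pobj -> zmodType;
  pidm : forall X, phom X X;
  pcomp : forall X Y Z, phom Y Z -> phom X Y -> phom X Z;
  pcomp1m : forall X Y (f : phom X Y), pcomp (pidm Y) f = f;
  pcompm1 : forall X Y (f : phom X Y), pcomp f (pidm X) = f;
  pcompA : forall W X Y Z (h : phom Y Z) (g : phom X Y) (f : phom W X),
    pcomp h (pcomp g f) = pcomp (pcomp h g) f;
  pcompDl : forall X Y Z (g g' : phom Y Z) (f : phom X Y),
    pcomp (g + g') f = pcomp g f + pcomp g' f;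
  pcompDr : forall X Y Z (g : phom Y Z) (f f' : phom X Y),
    pcomp g (f + f') = pcomp g f + pcomp g f' }.

Arguments pcomp {p X Y Z}.

Coercion category_of (C : preadditive) : category :=
  Category (@pcomp1m C) (@pcompm1 C) (@pcompA C).

Definition surj U V (f : U -> V) : Prop := forall v, exists u, f u = v.

Definition exact_at U V (W : zmodType) (f : U -> V) (g : V -> W) : Prop :=
  forall v, g v = 0 <-> exists u, f u = v.

(* Contravariant additive functors from C to abelian groups. *)
Record functor (C : preadditive) := Functor {
  fobj :> C -> zmodType;
  fmap : forall X Y, phom X Y -> {additive fobj Y -> fobj X};
  fmap1 : forall X x, fmap (pidm X) x = x;
  fmapM : forall X Y Z (g : phom Y Z) (f : phom X Y) x,
    fmap (pcomp g f) x = fmap f (fmap g x);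
  fmapD : forall X Y (f g : phom X Y) x, fmap (f + g) x = fmap f x + fmap g x }.

Record nattrans (C : preadditive) (F G : functor C) := NatTrans {
  ncomp :> forall X, {additive F X -> G X};
  ncompP : forall X Y (f : phom X Y) y,
    ncomp X (fmap F f y) = fmap G f (ncomp Y y) }.

Lemma additive_eq (U V : zmodType) (f g : {additive U -> V}) : f =1 g -> f = g.
Proof.
case: f g => [f [[[f0 fD]]]] [g [[[g0 gD]]]] /= /funext e.
case: _ / e g0 gD => g0 gD.
by rewrite (Prop_irrelevance f0 g0) (Prop_irrelevance fD gD).
Qed.

Lemma nattrans_eq (C : preadditive) (F G : functor C) (a b : nattrans F G) :
  (forall X, a X =1 b X) -> a = b.
Proof.
case: a b => [a aP] [b bP] /= e.
have ab : a = b.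
  by apply: functional_extensionality_dep => X; exact/additive_eq/e.
by case: _ / ab bP {e} => bP; rewrite (Prop_irrelevance aP bP).
Qed.

Section FunctorCategory.
Variable C : preadditive.

Program Definition nattrans_id (F : functor C) : nattrans F F :=
  @NatTrans C F F (fun X => idfun) _.
Next Obligation. by []. Qed.

Program Definition nattrans_comp (F G H : functor C)
    (b : nattrans G H) (a : nattrans F G) : nattrans F H :=
  @NatTrans C F H (fun X => b X \o a X) _.
Next Obligation. by move=> F G H b a X Y f y; rewrite /= !ncompP. Qed.

Section Representable.
Variable X : C.

Definition precomp Y Z (f : phom Y Z) (g : phom Z X) : phom Y X := pcomp g f.

Fact precomp_is_nmod_morphism Y Z (f : phom Y Z) : nmod_morphism (precomp f).
Proof.
have fD g h : precomp f (g + h) = precomp f g + precomp f h by exact: pcompDl.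
by split=> //; apply: (addrI (precomp f 0)); rewrite -fD !addr0.
Qed.
HB.instance Definition _ Y Z (f : phom Y Z) :=
  GRing.isNmodMorphism.Build _ _ (precomp f) (precomp_is_nmod_morphism f).

Program Definition representable : functor C :=
  @Functor C (fun Y => phom Y X) (fun Y Z f => precomp f) _ _ _.
Next Obligation. by move=> Y x; apply: pcompm1. Qed.
Next Obligation. by move=> W Y Z g f x; apply: pcompA. Qed.
Next Obligation. by move=> Y Z f g x; apply: pcompDr. Qed.

End Representable.

(* Kernels and images of natural transformations are computed objectwise. *)
Definition finitely_presented (F : functor C) : Prop :=
  exists X1 X0 (a : nattrans (representable X1) (representable X0))
         (b : nattrans (representable X0) F),
    forall X, exact_at (a X) (b X) /\ surj (b X).

Program Definition modf : category :=
  @Category {F : functor C | finitely_presented F}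
    (fun F G => nattrans (sval F) (sval G))
    (fun F => nattrans_id (sval F)) (fun F G H b a => nattrans_comp b a) _ _ _.
Next Obligation. by move=> *; apply: nattrans_eq. Qed.
Next Obligation. by move=> *; apply: nattrans_eq. Qed.
Next Obligation. by move=> *; apply: nattrans_eq. Qed.

End FunctorCategory.

Definition noetherian (R : comPzRingType) : Prop :=
  forall I : R -> Prop,
    I 0 -> (forall x y, I x -> I y -> I (x + y)) ->
    (forall a x, I x -> I (a * x)) ->
    exists n (e : 'I_n -> R), (forall i, I (e i)) /\
      forall x, I x -> exists c : 'I_n -> R, x = \sum_i c i * e i.

Lemma linear_eq (R : pzRingType) (U V : lmodType R) (f g : {linear U -> V}) :
  f =1 g -> f = g.
Proof.
case: f g => [f [[[f0 fD]] [fZ]]] [g [[[g0 gD]] [gZ]]] /= /funext e.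
case: _ / e g0 gD gZ => g0 gD gZ.
by rewrite (Prop_irrelevance f0 g0) (Prop_irrelevance fD gD)
           (Prop_irrelevance fZ gZ).
Qed.

Section HomModule.
Variables (R : comPzRingType) (U V : lmodType R).
Local Notation homUV := {linear U -> V}.

HB.instance Definition _ := gen_eqMixin homUV.
HB.instance Definition _ := gen_choiceMixin homUV.

Definition lin_zero : homUV := \0.
Definition lin_opp (f : homUV) : homUV := \- f.
Definition lin_add (f g : homUV) : homUV := f \+ g.
Definition lin_scale (a : R) (f : homUV) : homUV := a \*: f.

Fact lin_addA : associative lin_add.
Proof. by move=> f g h; apply: linear_eq => x /=; rewrite addrA. Qed.
Fact lin_addC : commutative lin_add.
Proof. by move=> f g; apply: linear_eq => x /=; rewrite addrC. Qed.
Fact lin_add0 : left_id lin_zero lin_add.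
Proof. by move=> f; apply: linear_eq => x /=; rewrite add0r. Qed.
Fact lin_addN : left_inverse lin_zero lin_opp lin_add.
Proof. by move=> f; apply: linear_eq => x /=; rewrite addNr. Qed.
HB.instance Definition _ :=
  GRing.isZmodule.Build homUV lin_addA lin_addC lin_add0 lin_addN.

Fact lin_scaleA a b (f : homUV) :
  lin_scale a (lin_scale b f) = lin_scale (a * b) f.
Proof. by apply: linear_eq => x /=; rewrite scalerA. Qed.
Fact lin_scale1 : left_id 1 lin_scale.
Proof. by move=> f; apply: linear_eq => x /=; rewrite scale1r. Qed.
Fact lin_scaleDr : right_distributive lin_scale +%R.
Proof. by move=> a f g; apply: linear_eq => x /=; rewrite scalerDr. Qed.
Fact lin_scaleDl (f : homUV) : {morph lin_scale^~ f : a b / a + b}.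
Proof. by move=> a b; apply: linear_eq => x /=; rewrite scalerDl. Qed.
HB.instance Definition _ :=
  GRing.Zmodule_isLmodule.Build R homUV lin_scaleA lin_scale1 lin_scaleDr
    lin_scaleDl.

End HomModule.

Section Modules.
Variable R : comPzRingType.

Definition finitely_generated (M : lmodType R) : Prop :=
  exists n (e : 'I_n -> M),
    forall x, exists c : 'I_n -> R, x = \sum_i c i *: e i.

Definition projective (P : lmodType R) : Prop :=
  forall (M N : lmodType R) (g : {linear M -> N}) (f : {linear P -> N}),
    surj g -> exists h : {linear P -> M}, forall x, g (h x) = f x.

Definition short_exact (U V W : lmodType R)
    (f : {linear U -> V}) (g : {linear V -> W}) : Prop :=
  [/\ injective f, exact_at f g & surj g].

Record fgmod := FgMod {
  fgmod_sort :> lmodType R;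
  fgmodP : finitely_generated fgmod_sort }.

Program Definition modcat : preadditive :=
  @Preadditive fgmod (fun X Y => {linear X -> Y} : zmodType) (fun X => idfun)
    (fun X Y Z g f => g \o f) _ _ _ _ _.
Next Obligation. by move=> *; apply: linear_eq. Qed.
Next Obligation. by move=> *; apply: linear_eq. Qed.
Next Obligation. by move=> *; apply: linear_eq. Qed.
Next Obligation. by move=> *; apply: linear_eq. Qed.
Next Obligation. by move=> *; apply: linear_eq => x /=; rewrite linearD. Qed.

Fact dsum_finitely_generated (X Y : fgmod) :
  finitely_generated (X * Y : lmodType R)%type.
Proof.
case: X Y => [X [m [e eP]]] [Y [n [f fP]]]; exists (m + n)%N.
exists (fun i => match split i with inl j => (e j, 0) | inr j => (0, f j) end).
case=> x y; have [c ->] := eP x; have [d ->] := fP y.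
exists (fun i => match split i with inl j => c j | inr j => d j end).
rewrite big_split_ord /= [RHS]surjective_pairing; congr pair.
  rewrite raddfD /= !raddf_sum /= [X in _ + X]big1 ?addr0 => [|j _].
    by apply: eq_bigr => j _; rewrite (unsplitK (inl j)).
  by rewrite (unsplitK (inr j)) /= scaler0.
rewrite raddfD /= !raddf_sum /= [X in X + _]big1 ?add0r => [|j _].
  by apply: eq_bigr => j _; rewrite (unsplitK (inr j)).
by rewrite (unsplitK (inl j)) /= scaler0.
Qed.

Definition dsum (X Y : fgmod) : fgmod := FgMod (dsum_finitely_generated X Y).

Definition factors_through_projective (X Y : lmodType R) (f : {linear X -> Y}) :
    Prop :=
  exists (P : lmodType R) (g : {linear X -> P}) (h : {linear P -> Y}),
    projective P /\ forall x, f x = h (g x).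

Definition proj_maps (X Y : lmodType R) : {pred {linear X -> Y}} :=
  fun f => `[< factors_through_projective f >].

Fact projective_prod (P Q : lmodType R) :
  projective P -> projective Q -> projective (P * Q : lmodType R)%type.
Proof.
move=> hP hQ M N g f gs.
pose inP (x : P) : P * Q := (x, 0); pose inQ (y : Q) : P * Q := (0, y).
have inPl : linear inP by move=> a x y; congr pair; rewrite /= scaler0 addr0.
have inQl : linear inQ by move=> a x y; congr pair; rewrite /= scaler0 addr0.
pose iP : {linear P -> (P * Q)%type} :=
  HB.pack inP (GRing.isLinear.Build _ _ _ _ _ inPl).
pose iQ : {linear Q -> (P * Q)%type} :=
  HB.pack inQ (GRing.isLinear.Build _ _ _ _ _ inQl).
have [u uP] := hP _ _ g (f \o iP) gs; have [v vP] := hQ _ _ g (f \o iQ) gs.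
exists ((u \o fst) \+ (v \o snd)) => -[x y] /=.
rewrite raddfD /= uP vP /= -raddfD; congr (f _).
by congr pair; rewrite /= ?addr0 ?add0r.
Qed.

Fact projective_zero : projective ('rV[R]_0 : lmodType R).
Proof.
move=> M N g f _; exists \0 => x /=.
by rewrite raddf0 [x]thinmx0 raddf0.
Qed.

Fact proj_maps_zmod_closed (X Y : lmodType R) : zmod_closed (@proj_maps X Y).
Proof.
split=> [|f f' /asboolP[P [g [h [hP fE]]]] /asboolP[P' [g' [h' [hP' fE']]]]].
  by apply/asboolP; exists 'rV[R]_0, \0, \0; split=> //; exact: projective_zero.
apply/asboolP; pose k x : P * P' := (g x, g' x).
have kl : linear k by move=> a x y; rewrite /k !linearP.
pose kL : {linear X -> (P * P')%type} :=
  HB.pack k (GRing.isLinear.Build _ _ _ _ _ kl).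
exists (P * P')%type, kL, ((h \o fst) \- (h' \o snd)); split=> [|x /=].
  exact: projective_prod.
by rewrite -fE -fE'.
Qed.
HB.instance Definition _ X Y :=
  GRing.isZmodClosed.Build _ (@proj_maps X Y) (@proj_maps_zmod_closed X Y).

Local Notation quot X Y := (Quotient.quot (@proj_maps X Y)).

(* Hom(X, Y) / P(X, Y) *)
Definition stable_hom (X Y : lmodType R) : zmodType := quot X Y.

Definition stable_class (X Y : lmodType R) (f : {linear X -> Y}) :
    stable_hom X Y := \pi_(quot X Y) f.

Definition stable_comp (X Y Z : lmodType R)
    (g : stable_hom Y Z) (f : stable_hom X Y) : stable_hom X Z :=
  stable_class (repr (g : quot Y Z) \o repr (f : quot X Y)).

Fact stable_classP (X Y : lmodType R) (f g : {linear X -> Y}) :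
  stable_class f = stable_class g <-> factors_through_projective (f - g).
Proof.
rewrite (rwP (asboolP (factors_through_projective _))).
rewrite -[`[< _ >]]/(f - g \in @proj_maps X Y) Quotient.idealrBE.
exact: rwP eqP.
Qed.

Fact stable_classD (X Y : lmodType R) (f g : {linear X -> Y}) :
  stable_class (f + g) = stable_class f + stable_class g.
Proof. exact: (raddfD \pi_(quot X Y)). Qed.

Fact stable_classK (X Y : lmodType R) (f : stable_hom X Y) :
  stable_class (repr (f : quot X Y)) = f.
Proof. exact: (@reprK _ (quot X Y)). Qed.

Fact stable_compE (X Y Z : lmodType R) (g : {linear Y -> Z})
    (f : {linear X -> Y}) :
  stable_comp (stable_class g) (stable_class f) = stable_class (g \o f).
Proof.
pose g' := repr (stable_class g : quot Y Z).
pose f' := repr (stable_class f : quot X Y).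
have /stable_classP[P [a [b [hP gE]]]] : stable_class g' = stable_class g.
  exact: stable_classK.
have /stable_classP[Q [c [d [hQ fE]]]] : stable_class f' = stable_class f.
  exact: stable_classK.
transitivity (stable_class (g \o f')).
  by apply/stable_classP; exists P, (a \o f'), b; split=> // x; apply: gE.
apply/stable_classP; exists Q, c, (g \o d); split=> // x.
by rewrite /= -fE /= raddfB.
Qed.

Fact stable_surj (X Y : lmodType R) : surj (@stable_class X Y).
Proof. by move=> f; exists (repr (f : quot X Y)); apply: stable_classK. Qed.

(* A subcategory C of mod R is given by its class of objects; the construction
   makes sense for any class of objects. *)
Section Stable.
Variable C : fgmod -> Prop.

Program Definition stable : preadditive :=
  @Preadditive {X : fgmod | C X} (fun X Y => stable_hom (sval X) (sval Y))
    (fun X => stable_class idfun) (fun X Y Z g f => stable_comp g f) _ _ _ _ _.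
Next Obligation.
move=> X Y f; have [f' <-] := stable_surj f; rewrite stable_compE.
by congr stable_class; apply: linear_eq.
Qed.
Next Obligation.
move=> X Y f; have [f' <-] := stable_surj f; rewrite stable_compE.
by congr stable_class; apply: linear_eq.
Qed.
Next Obligation.
move=> W X Y Z h g f; have [h' <-] := stable_surj h.
have [g' <-] := stable_surj g; have [f' <-] := stable_surj f.
by rewrite !stable_compE; congr stable_class; apply: linear_eq.
Qed.
Next Obligation.
move=> X Y Z g g' f; have [f1 <-] := stable_surj f.
have [g1 <-] := stable_surj g; have [g2 <-] := stable_surj g'.
rewrite -stable_classD !stable_compE -stable_classD.
by congr stable_class; apply: linear_eq.
Qed.
Next Obligation.
move=> X Y Z g f f'; have [g1 <-] := stable_surj g.
have [f1 <-] := stable_surj f; have [f2 <-] := stable_surj f'.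
rewrite -stable_classD !stable_compE -stable_classD.
by congr stable_class; apply: linear_eq => x /=; rewrite raddfD.
Qed.

End Stable.

Record resolution (X : fgmod) := Resolution {
  rterm : nat -> fgmod;
  rdiff : forall n, {linear rterm n.+1 -> rterm n};
  raug : {linear rterm 0 -> X};
  rterm_projective : forall n, projective (rterm n);
  raug_surj : surj raug;
  raug_exact : exact_at (rdiff 0) raug;
  rdiff_exact : forall n, exact_at (rdiff n.+1) (rdiff n) }.

Section Ext.
Variables (X : fgmod) (P : resolution X) (N : lmodType R).

Definition cochain n : zmodType := {linear rterm P n -> N}.

Definition cobound n (f : cochain n) : cochain n.+1 := f \o rdiff P n.

Fact cobound_is_zmod_morphism n : zmod_morphism (@cobound n).
Proof. by move=> f g; apply: linear_eq. Qed.
HB.instance Definition _ n :=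
  GRing.isZmodMorphism.Build _ _ (@cobound n) (@cobound_is_zmod_morphism n).

Definition is_cocycle n : {pred cochain n} := fun f => cobound f == 0.

Fact is_cocycle_zmod_closed n : zmod_closed (@is_cocycle n).
Proof.
split=> [|f g /eqP f0 /eqP g0]; first by rewrite /in_mem /= /is_cocycle raddf0.
by rewrite /in_mem /= /is_cocycle raddfB /= f0 g0 subr0.
Qed.
HB.instance Definition _ n :=
  GRing.isZmodClosed.Build _ (@is_cocycle n) (@is_cocycle_zmod_closed n).

Record cocycle n := Cocycle {
  cocycle_val : cochain n;
  _ : cocycle_val \in @is_cocycle n }.
HB.instance Definition _ n := [isSub for @cocycle_val n].
HB.instance Definition _ n := [Choice of cocycle n by <:].
HB.instance Definition _ n := [SubChoice_isSubZmodule of cocycle n by <:].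

Definition is_coboundary n : {pred cocycle n} :=
  match n with
  | 0 => fun f => f == 0
  | m.+1 => fun f => `[< exists g : cochain m, val f = cobound g >]
  end.

Fact is_coboundary_zmod_closed n : zmod_closed (@is_coboundary n).
Proof.
case: n => [|n]; split.
- exact: eqxx.
- by move=> f g /eqP -> /eqP ->; rewrite subr0; apply: eqxx.
- by apply/asboolP; exists 0; rewrite !raddf0.
move=> f g /asboolP[u fu] /asboolP[v gv]; apply/asboolP; exists (u - v).
by rewrite !raddfB /= fu gv.
Qed.
HB.instance Definition _ n :=
  GRing.isZmodClosed.Build _ (@is_coboundary n) (@is_coboundary_zmod_closed n).

(* Ext^n_R(X, N), computed from the chosen resolution P of X. *)
Definition Ext n : zmodType := Quotient.quot (@is_coboundary n).

End Ext.

(* Over a Noetherian ring every X : fgmod R has a resolution, and the vanishing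
   of Ext does not depend on it; likewise Tr and the syzygy below are relations
   because they depend on choices. *)
Definition Ext_vanishes (X : fgmod) (N : lmodType R) n : Prop :=
  exists P : resolution X, forall c : Ext P N n, c = 0.

(* T is a cokernel of Hom(P0, R) -> Hom(P1, R). *)
Definition is_transpose (X T : fgmod) : Prop :=
  exists (P1 P0 : fgmod) (d : {linear P1 -> P0}) (e : {linear P0 -> X})
         (q : {linear {linear P1 -> R^o} -> T}),
    [/\ projective P1, projective P0, exact_at d e /\ surj e
      & exact_at (fun f : {linear P0 -> R^o} => f \o d : {linear P1 -> R^o}) q
        /\ surj q].

Definition is_syzygy (X Z : fgmod) : Prop :=
  exists (P0 : fgmod) (f : {linear Z -> P0}) (g : {linear P0 -> X}),
    projective P0 /\ short_exact f g.

Definition catH (X : fgmod) : Prop :=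
  forall i, (0 < i)%N -> Ext_vanishes X R^o i.

Definition catG (X : fgmod) : Prop :=
  catH X /\ exists T, is_transpose X T /\ catH T.

Section Subcategories.
Variable C : fgmod -> Prop.

Definition subcategory : Prop :=
  [/\ forall X Y : fgmod, @isomorphic modcat X Y -> C X -> C Y,
      forall X Y, C (dsum X Y) <-> C X /\ C Y
    & forall P : fgmod, projective P -> C P].

Definition closed_under_kernels_of_epimorphisms : Prop :=
  forall (X Y Z : fgmod) (f : {linear X -> Y}) (g : {linear Y -> Z}),
    short_exact f g -> C Y -> C Z -> C X.

Definition extension_closed : Prop :=
  forall (X Y Z : fgmod) (f : {linear X -> Y}) (g : {linear Y -> Z}),
    short_exact f g -> C X -> C Z -> C Y.

Definition resolving : Prop :=
  closed_under_kernels_of_epimorphisms /\ extension_closed.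

(* Omega is onto the isomorphism classes of objects of the stable category: each
   X is, stably, a syzygy Z of some Y in C. *)
Definition syzygy_surjective : Prop :=
  forall X : stable C, exists Y Z : stable C,
    is_syzygy (sval Y) (sval Z) /\ @isomorphic (stable C) Z X.

End Subcategories.

End Modules.

(* Main.v *)
From HB Require Import structures.
From mathcomp Require Import all_boot all_algebra.
From mathcomp Require Import ring_quotient boolp.
Require Import Defs.

(* In the stable category of C every morphism f : X -> Y has a weak kernel of
   which it is a weak cokernel, namely the kernel K of a surjection X + P -> Y
   extending f; the second half uses Ext^1(Y, R) = 0. Every f is also a weak
   kernel: X is stably a syzygy, so it may be assumed to embed in a projective P
   with cokernel in C, and the cokernel of X -> Y + P lies in C. Freyd's
   argument then shows that the representable functors on such a category are
   projective and injective in mod C, and that each finitely presented functor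
   is a quotient and a subobject of a representable one.

   For G, call X good when X lies in H and embeds in a projective module with
   good cokernel (coinductively). The modules of G-dimension zero are exactly
   the good ones: the kernel of P1* -> Tr X is a transpose of the cokernel of
   X -> Q, so that Ext^{n+1}(Tr X, R) can be shifted along cosyzygies. Goodness
   is visibly stable under extensions, kernels of epimorphisms and retracts. *)

Set Implicit Arguments.
Unset Strict Implicit.
Unset Printing Implicit Defensive.

Import GRing.Theory.
Local Open Scope ring_scope.
Local Open Scope quotient_scope.

Fact nmod_morphism_of_add (U V : zmodType) (f : U -> V) :
  (forall x y, f (x + y) = f x + f y) -> nmod_morphism f.
Proof. by move=> fD; split=> //; apply: (addrI (f 0)); rewrite -fD !addr0. Qed.

Definition additive_of (U V : zmodType) (f : U -> V)
    (fD : forall x y, f (x + y) = f x + f y) : {additive U -> V} :=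
  HB.pack f (GRing.isNmodMorphism.Build U V f (nmod_morphism_of_add fD)).

(** * Finitely presented functors *)

Section Preadditive.
Variable A : preadditive.
Implicit Types X Y Z : A.

Lemma pcomp0m X Y Z (f : phom X Y) : pcomp (0 : phom Y Z) f = 0.
Proof. by apply: (addrI (pcomp 0 f)); rewrite -pcompDl !addr0. Qed.

Lemma pcompm0 X Y Z (g : phom Y Z) : pcomp g (0 : phom X Y) = 0.
Proof. by apply: (addrI (pcomp g 0)); rewrite -pcompDr !addr0. Qed.

Lemma pcompNm X Y Z (g : phom Y Z) (f : phom X Y) : pcomp (- g) f = - pcomp g f.
Proof. by apply/eqP; rewrite -addr_eq0 -pcompDl addNr pcomp0m. Qed.

Lemma pcompmN X Y Z (g : phom Y Z) (f : phom X Y) : pcomp g (- f) = - pcomp g f.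
Proof. by apply/eqP; rewrite -addr_eq0 -pcompDr addNr pcompm0. Qed.

(** Exactness of [Hom(T, K) -> Hom(T, X) -> Hom(T, Y)] for every [T]: a kernel whose factorizations
    [s] need not be unique. *)
Definition weak_kernel K X Y (k : phom K X) (f : phom X Y) : Prop :=
  forall T (t : phom T X), pcomp f t = 0 <-> exists s, pcomp k s = t.

Definition weak_cokernel K X Y (f : phom X Y) (k : phom K X) : Prop :=
  forall T (t : phom X T), pcomp t k = 0 <-> exists s, pcomp s f = t.

Definition is_biproduct X Y S (i1 : phom X S) (i2 : phom Y S)
    (p1 : phom S X) (p2 : phom S Y) : Prop :=
  [/\ pcomp p1 i1 = pidm X, pcomp p2 i2 = pidm Y, pcomp p1 i2 = 0,
      pcomp p2 i1 = 0 & pcomp i1 p1 + pcomp i2 p2 = pidm S].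

Implicit Types F G H : functor A.

Lemma fmap0 F X Y (x : F Y) : fmap F (0 : phom X Y) x = 0.
Proof. by apply: (addrI (fmap F 0 x)); rewrite -fmapD !addr0. Qed.

Lemma fmapN F X Y (f : phom X Y) (x : F Y) : fmap F (- f) x = - fmap F f x.
Proof. by apply/eqP; rewrite -addr_eq0 -fmapD addNr fmap0. Qed.

Definition nat_of F G (f : forall X, F X -> G X)
    (fD : forall X x y, f X (x + y) = f X x + f X y)
    (fN : forall X Y (t : phom X Y) y, f X (fmap F t y) = fmap G t (f Y y)) :
    nattrans F G :=
  @NatTrans A F G (fun X => additive_of (fD X)) fN.

Definition zero_nat F G : nattrans F G.
Proof.
by apply: (@nat_of F G (fun X x => 0)) => *; rewrite ?addr0 ?raddf0.
Defined.

Definition yoneda F X (x : F X) : nattrans (representable X) F.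
Proof.
apply: (@nat_of (representable X) F (fun Y (t : phom Y X) => fmap F t x)).
  by move=> Y s t; apply: fmapD.
by move=> Y Z s t; apply: fmapM.
Defined.

Lemma nat_representable F X (a : nattrans (representable X) F) Y
    (t : phom Y X) : a Y t = fmap F t (a X (pidm X)).
Proof. by rewrite -ncompP /= /precomp pcomp1m. Qed.

(* By Yoneda, a presentation of F is a morphism a and an element x of F X0. *)
Definition presents F X1 X0 (a : phom X1 X0) (x : F X0) : Prop :=
  forall Y, surj (fun t : phom Y X0 => fmap F t x) /\
            exact_at (fun s : phom Y X1 => pcomp a s) (fun t => fmap F t x).

Lemma finitely_presentedP F : finitely_presented F <->
  exists X1 X0 (a : phom X1 X0) (x : F X0), presents a x.
Proof.
split=> [[X1 [X0 [a [b abP]]]]|[X1 [X0 [a [x axP]]]]].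
  exists X1, X0, (a X1 (pidm X1)), (b X0 (pidm X0)) => Y.
  have [ab bs] := abP Y; split=> [y|t].
    by have [t <-] := bs y; exists t; rewrite -nat_representable.
  rewrite -nat_representable ab; split=> -[s <-]; exists s.
    by rewrite [RHS]nat_representable.
  by rewrite [LHS]nat_representable.
exists X1, X0, (yoneda (F := representable X0) a), (yoneda x) => Y.
by have [? ?] := axP Y; split.
Qed.

Lemma presents_fmap X1 X0 F (a : phom X1 X0) (x : F X0) :
  presents a x -> fmap F a x = 0.
Proof. by case/(_ X1)=> _ axP; apply/axP; exists (pidm X1); apply: pcompm1. Qed.

(** A presentation makes [x] the universal element killed by [a]: writing [z] as [fmap F t x] fixes
    [t] up to morphisms through [a], so sending [z] to [fmap G t y] is well defined. *)
Lemma nat_of_presents X1 X0 F G (a : phom X1 X0) (x : F X0) (y : G X0) :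
  presents a x -> fmap G a y = 0 -> exists u : nattrans F G, u X0 x = y.
Proof.
move=> axP ay.
have wd Y (s t : phom Y X0) : fmap F s x = fmap F t x ->
  fmap G s y = fmap G t y.
  move=> e; have : fmap F (s - t) x = 0 by rewrite fmapD fmapN e addrN.
  case/(proj2 (axP Y)) => r; move/esym/eqP; rewrite subr_eq => /eqP ->.
  by rewrite fmapD fmapM ay raddf0 add0r.
pose c Y (z : F Y) := sval (cid (proj1 (axP Y) z)).
have cP Y z : fmap F (c Y z) x = z by rewrite /c; case: cid.
unshelve eexists (@nat_of F G (fun Y z => fmap G (c Y z) y) _ _).
- by move=> Y z z'; rewrite -fmapD; apply: wd; rewrite fmapD !cP.
- by move=> Y Z t z; rewrite -fmapM; apply: wd; rewrite fmapM !cP.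
by rewrite /= -[RHS]fmap1; apply: wd; rewrite cP fmap1.
Qed.

Lemma nat_presents_eq X1 X0 F G (a : phom X1 X0) (x : F X0)
    (u v : nattrans F G) : presents a x -> u X0 x = v X0 x -> u = v.
Proof.
move=> axP e; apply: nattrans_eq => Y z.
by have [t <-] := proj1 (axP Y) z; rewrite !ncompP e.
Qed.

(** * Cokernels of maps between representable functors *)

Section CokernelFunctor.
Variables (X1 X0 : A) (a : phom X1 X0).

Definition in_image Y : {pred phom Y X0} :=
  fun t => `[< exists s, pcomp a s = t >].

Fact in_image_zmod_closed Y : zmod_closed (@in_image Y).
Proof.
split=> [|t t' /asboolP[s <-] /asboolP[s' <-]]; apply/asboolP.
  by exists 0; apply: pcompm0.
by exists (s - s'); rewrite pcompDr pcompmN.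
Qed.
HB.instance Definition _ Y :=
  GRing.isZmodClosed.Build _ (@in_image Y) (@in_image_zmod_closed Y).

Local Notation coker Y := (Quotient.quot (@in_image Y)).

Fact coker_piP Y (s t : phom Y X0) :
  \pi_(coker Y) s = \pi_(coker Y) t <-> exists r, pcomp a r = s - t.
Proof.
rewrite (rwP (asboolP (exists _, _))).
rewrite -[`[< _ >]]/(s - t \in @in_image Y) Quotient.idealrBE.
exact: rwP eqP.
Qed.

Definition coker_fmap Y Z (f : phom Y Z) (c : coker Z) : coker Y :=
  \pi_(coker Y) (pcomp (repr c) f).

Fact coker_fmapE Y Z (f : phom Y Z) t :
  coker_fmap f (\pi_(coker Z) t) = \pi_(coker Y) (pcomp t f).
Proof.
have /coker_piP[r rP] := reprK (\pi_(coker Z) t).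
by apply/coker_piP; exists (pcomp r f); rewrite pcompA rP pcompDl pcompNm.
Qed.

Lemma coker_ind Y (P : coker Y -> Prop) : (forall t, P (\pi t)) ->
  forall c, P c.
Proof. by move=> h c; rewrite -[c]reprK. Qed.

Fact coker_fmap_add Y Z (f : phom Y Z) (c d : coker Z) :
  coker_fmap f (c + d) = coker_fmap f c + coker_fmap f d.
Proof.
move: c d; apply: coker_ind => s; apply: coker_ind => t.
by rewrite -raddfD !coker_fmapE pcompDl raddfD.
Qed.

Definition coker_functor : functor A.
Proof.
refine (@Functor A (fun Y => coker Y) (fun Y Z f =>
  additive_of (coker_fmap_add f))
  _ _ _).
- by move=> Y; apply: coker_ind => t; rewrite /= coker_fmapE pcompm1.
- by move=> W Y Z g f; apply: coker_ind => t;
  rewrite /= !(coker_fmapE _ t) coker_fmapE pcompA.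
move=> Y Z f g; apply: coker_ind => t.
by rewrite /= !coker_fmapE pcompDr raddfD.
Defined.

(** The class of the identity of [X0] generates the cokernel functor, with [a] as its relation; the
    kernels and cokernels below are built as such functors. *)
Lemma coker_presents : exists F (x : F X0), presents a x.
Proof.
exists coker_functor, (\pi_(coker X0) (pidm X0)) => Y; split.
  by apply: coker_ind => t; exists t; rewrite /= coker_fmapE pcomp1m.
move=> t; rewrite /= coker_fmapE pcomp1m -(raddf0 \pi_(coker Y)) coker_piP
  subr0.
by split.
Qed.

End CokernelFunctor.

Lemma representable_presents X :
  @presents (representable X) X X 0 (pidm X).
Proof.
move=> Y; split=> [t|t] /=; rewrite /precomp ?pcomp1m.
  by exists t; rewrite pcomp1m.
split=> [->|[s <-]]; last exact: pcomp0m.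
by exists 0; apply: pcomp0m.
Qed.

Definition prod_functor F G : functor A.
Proof.
refine (@Functor A (fun Y => (F Y * G Y)%type : zmodType)
  (fun Y Z f => @additive_of (F Z * G Z)%type (F Y * G Y)%type
     (fun z => (fmap F f z.1, fmap G f z.2)) _) _ _ _).
- by move=> Y [x y]; rewrite /= !fmap1.
- by move=> W Y Z g f [x y]; rewrite /= !fmapM.
- by move=> Y Z f g [x y]; rewrite /= !fmapD.
Unshelve.
by move=> [x y] [x' y']; congr pair; rewrite /= raddfD.
Defined.

End Preadditive.

(** * The Frobenius property from weak kernels and weak cokernels *)

Section ModfFrobenius.
Variable A : preadditive.
Hypothesis zero_obj : exists Z : A, pidm Z = 0.
Hypothesis biproducts : forall X Y : A,
  exists S (i1 : phom X S) (i2 : phom Y S) (p1 : phom S X) (p2 : phom S Y),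
    is_biproduct i1 i2 p1 p2.
Hypothesis weak_kernels : forall (X Y : A) (f : phom X Y),
  exists K (k : phom K X), weak_kernel k f /\ weak_cokernel f k.
Hypothesis weak_kernel_of : forall (X Y : A) (f : phom X Y),
  exists Z (g : phom Y Z), weak_kernel f g.
Implicit Types F G H : functor A.

(** If [x] is [fmap F w y] for a presentation [b], [y] of [F], then [t] kills [x] exactly when
    [w t = b s] for some [s], that is, when [(t, s)] factors through a weak kernel of [(w, -b)] on
    the sum of [X0] and [Y1]. *)
Lemma annihilator_generated F X0 (x : F X0) : finitely_presented F ->
  exists K (k : phom K X0), forall Y,
    exact_at (fun s : phom Y K => pcomp k s) (fun t => fmap F t x).
Proof.
case/finitely_presentedP=> Y1 [Y0 [b [y byP]]].
have [w <-] := proj1 (byP X0) x.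
have [S [i1 [i2 [p1 [p2 [p1i1 p2i2 p1i2 p2i1 _]]]]]] := biproducts X0 Y1.
have [K [k [kP _]]] := weak_kernels (pcomp w p1 - pcomp b p2).
exists K, (pcomp p1 k) => Y t; rewrite -fmapM (proj2 (byP Y)).
have kP' := kP Y; split=> -[s sP].
  have /kP'[r rP] : pcomp (pcomp w p1 - pcomp b p2)
      (pcomp i1 t + pcomp i2 s) = 0.
    rewrite pcompDl pcompNm !pcompDr -!pcompA !(pcompA p1) !(pcompA p2).
    by rewrite p1i1 p1i2 p2i1 p2i2 !pcomp0m !pcomp1m !pcompm0 addr0 add0r sP
      subrr.
  exists r; rewrite -pcompA rP pcompDr !pcompA p1i1 p1i2.
  by rewrite pcomp0m pcomp1m addr0.
have : pcomp (pcomp w p1 - pcomp b p2) (pcomp k s) = 0 by apply/kP'; exists s.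
rewrite pcompDl pcompNm => /eqP; rewrite subr_eq0 => /eqP e.
by exists (pcomp (pcomp p2 k) s); move: e; rewrite -sP !pcompA.
Qed.

(** Annihilators are taken twice: [k] generates the annihilator of [u x], so the multiple of [x] by
    [k] generates the kernel, and the relations [l] on that element present it. *)
Lemma kernel_functor F G (u : nattrans F G) :
  finitely_presented F -> finitely_presented G ->
  exists N (m : nattrans N F), finitely_presented N /\
    forall X, injective (m X) /\ exact_at (m X) (u X).
Proof.
move=> fpF fpG; have /finitely_presentedP[X1 [X0 [a [x axP]]]] := fpF.
have [K [k kP]] := annihilator_generated (u X0 x) fpG.
have [L [l lP]] := annihilator_generated (fmap F k x) fpF.
have [N [n nP]] := coker_presents l.
have /(nat_of_presents nP)[m mP] : fmap F l (fmap F k x) = 0.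
  by apply/lP; exists (pidm L); apply: pcompm1.
have mE Y t : m Y (fmap N t n) = fmap F (pcomp k t) x by rewrite ncompP mP
  -fmapM.
exists N, m; split; first by apply/finitely_presentedP; exists L, K, l, n.
move=> Y; split=> [|y].
  apply: raddf_inj => z; have [t <-] := proj1 (nP Y) z.
  by rewrite mE fmapM => /lP; apply: (proj2 (proj2 (nP Y) _)).
have [t <-] := proj1 (axP Y) y; rewrite ncompP; split.
  by case/kP=> s <-; exists (fmap N s n); rewrite mE.
case=> z; have [s <-] := proj1 (nP Y) z; rewrite mE -ncompP => <-.
by rewrite ncompP; apply/kP; exists s.
Qed.

(** The cokernel keeps the generator [y] of [G]; its relations are those of [G] together with a lift
    [w] of the image of the generator of [F]. *)
Lemma cokernel_functor F G (u : nattrans F G) :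
  finitely_presented F -> finitely_presented G ->
  exists Q (c : nattrans G Q), finitely_presented Q /\
    forall X, exact_at (u X) (c X) /\ surj (c X).
Proof.
case/finitely_presentedP=> X1 [X0 [a [x axP]]].
case/finitely_presentedP=> Y1 [Y0 [b [y byP]]].
have [w wP] := proj1 (byP X0) (u X0 x).
have [S [i1 [i2 [p1 [p2 [p1i1 p2i2 p1i2 p2i1 _]]]]]] := biproducts X0 Y1.
set d := pcomp w p1 + pcomp b p2.
have di1 : pcomp d i1 = w.
  by rewrite pcompDl -!pcompA p1i1 p2i1 pcompm0 pcompm1 addr0.
have di2 : pcomp d i2 = b.
  by rewrite pcompDl -!pcompA p2i2 p1i2 pcompm0 pcompm1 add0r.
have [Q [z dzP]] := coker_presents d.
have /(nat_of_presents byP)[c cP] : fmap Q b z = 0.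
  by apply/(proj2 (dzP _)); exists i2.
exists Q, c; split; first by apply/finitely_presentedP; exists S, Y0, d, z.
move=> Y; split=> [v|v]; last first.
  by have [t <-] := proj1 (dzP Y) v; exists (fmap G t y); rewrite ncompP cP.
have [t <-] := proj1 (byP Y) v; rewrite ncompP cP (proj2 (dzP Y)); split.
  case=> s <-; exists (fmap F (pcomp p1 s) x).
  rewrite pcompDl fmapD -!pcompA (fmapM b) (presents_fmap byP) raddf0 addr0.
  by rewrite (fmapM w) wP ncompP.
case=> v'; have [r <-] := proj1 (axP Y) v'; rewrite ncompP -wP -fmapM => e.
have : fmap G (t - pcomp w r) y = 0 by rewrite fmapD fmapN -e subrr.
case/(proj2 (byP Y))=> s sP; exists (pcomp i1 r + pcomp i2 s).
by rewrite pcompDr !pcompA di1 di2 sP addrC subrK.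
Qed.

Lemma representable_fp (X : A) : finitely_presented (representable X).
Proof.
apply/finitely_presentedP.
by exists X, X, 0, (pidm X : representable X X); apply: representable_presents.
Qed.

Lemma prod_fp F G : finitely_presented F -> finitely_presented G ->
  finitely_presented (prod_functor F G).
Proof.
case/finitely_presentedP=> X1 [X0 [a [x axP]]].
case/finitely_presentedP=> Y1 [Y0 [b [y byP]]].
have [S [i1 [i2 [p1 [p2 [p1i1 p2i2 p1i2 p2i1 ip]]]]]] := biproducts X0 Y0.
have [T [j1 [j2 [q1 [q2 [q1j1 q2j2 q1j2 q2j1 _]]]]]] := biproducts X1 Y1.
apply/finitely_presentedP.
exists T, S, (pcomp (pcomp i1 a) q1 + pcomp (pcomp i2 b) q2).
exists (fmap F p1 x, fmap G p2 y) => Y; split=> [[v w]|t].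
  have [s <-] := proj1 (axP Y) v; have [t <-] := proj1 (byP Y) w.
  exists (pcomp i1 s + pcomp i2 t).
  rewrite /= -!fmapM !pcompDr !pcompA p1i1 p1i2 p2i1 p2i2.
  by rewrite !pcomp0m !pcomp1m addr0 add0r.
rewrite /= -!fmapM; split.
  case=> /(proj2 (axP Y))[r rP] /(proj2 (byP Y))[s sP].
  exists (pcomp j1 r + pcomp j2 s).
  rewrite pcompDl !pcompDr -!pcompA !(pcompA q1) !(pcompA q2).
  rewrite q1j1 q1j2 q2j1 q2j2 !pcomp0m !pcomp1m !pcompm0 addr0 add0r rP sP.
  by rewrite !pcompA -pcompDl ip pcomp1m.
case=> s <-; rewrite pcompDl; congr pair; rewrite !pcompDr !pcompA.
  rewrite p1i1 p1i2 pcomp1m !pcomp0m addr0; apply/(proj2 (axP Y)).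
  by exists (pcomp q1 s); rewrite pcompA.
rewrite p2i1 p2i2 pcomp1m !pcomp0m add0r; apply/(proj2 (byP Y)).
by exists (pcomp q2 s); rewrite pcompA.
Qed.

Local Notation M := (modf A).

Definition zero_nattrans (F G : M) : @hom M F G := zero_nat (sval F) (sval G).

Lemma zero_object_modf : exists Z : M, @zero_object M Z.
Proof.
have [Z Z0] := zero_obj; exists (exist _ _ (representable_fp Z)).
have all0 Y (t : phom Y Z) : t = 0 by rewrite -[t]pcomp1m Z0 pcomp0m.
split=> F; exists (zero_nattrans _ _); split=> // f _;
  apply: nattrans_eq => Y t /=.
  by rewrite (all0 _ (f Y t)).
by rewrite (all0 _ t) raddf0.
Qed.

Lemma zero_morphismP (F G : M) (f : @hom M F G) :
  @zero_morphism M F G f <-> forall X x, f X x = 0.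
Proof.
split=> [[Z [g [h [[_ Z0] ->]]]] X x /=|f0].
  have [i [_ iP]] := Z0 Z.
  have e : @idm M Z = zero_nattrans Z Z by rewrite -[LHS]iP // -[RHS]iP.
  have z0 (z : sval Z X) : z = 0.
    by rewrite -[LHS]/((@idm M Z : nattrans _ _) X z) e.
  by rewrite (z0 (h X x)) raddf0.
have [Z Z0] := zero_object_modf.
exists Z, (zero_nattrans _ _), (zero_nattrans _ _); split=> //.
by apply: nattrans_eq => X x; rewrite f0.
Qed.

(** By Yoneda an element [x] killed by [f] is a map from a representable functor with zero
    composite, so a monomorphism forces it to be zero. *)
Lemma mono_modfP (F G : M) (f : @hom M F G) :
  @mono M F G f <-> forall X, injective (f X).
Proof.
split=> [fm X|fi W g h /= e].
  apply: raddf_inj => x fx0.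
  have := fm (exist _ _ (representable_fp X)) (yoneda x) (zero_nattrans _ _).
  have -> : comp f (yoneda x : @hom M (exist _ _ (representable_fp X)) F) =
            comp f (zero_nattrans _ _).
    by apply: nattrans_eq => Y t; rewrite /= ncompP fx0 !raddf0.
  by move=> /(_ erefl) e; rewrite -[x]fmap1 -[LHS]/(yoneda x X (pidm X)) e.
apply: nattrans_eq => X x; apply: (fi X).
by rewrite -[LHS]/(nattrans_comp f g X x) e.
Qed.

Lemma epi_modfP (F G : M) (f : @hom M F G) :
  @epi M F G f <-> forall X, surj (f X).
Proof.
split=> [fe X y|fs W g h /= e].
  have [Q [c [fpQ cP]]] := cokernel_functor f (svalP F) (svalP G).
  apply/(proj1 (cP X)).
  have -> // : c = zero_nattrans G (exist _ Q fpQ).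
  apply: (fe (exist _ Q fpQ)); apply: nattrans_eq => Y x /=.
  by apply/(proj1 (cP Y)); exists x.
apply: nattrans_eq => X y; have [x <-] := fs X y.
by rewrite -[LHS]/(nattrans_comp g f X x) e.
Qed.

Lemma nat_lift F G H (m : nattrans F G) (h : nattrans H G) :
  (forall X, injective (m X)) -> (forall X x, exists y, m X y = h X x) ->
  exists u : nattrans H F, forall X x, m X (u X x) = h X x.
Proof.
move=> mi hP; pose u X x := sval (cid (hP X x)).
have uP X x : m X (u X x) = h X x by rewrite /u; case: cid.
unshelve eexists (@nat_of _ H F u _ _) => //.
  by move=> X x y; apply: (mi X); rewrite raddfD !uP raddfD.
by move=> X Y t y; apply: (mi X); rewrite ncompP !uP ncompP.
Qed.

Lemma nat_descend F G H (e : nattrans F G) (h : nattrans F H) :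
  (forall X, surj (e X)) -> (forall X x, e X x = 0 -> h X x = 0) ->
  exists u : nattrans G H, forall X x, u X (e X x) = h X x.
Proof.
move=> es hP; pose s X y := sval (cid (es X y)).
have sP X y : e X (s X y) = y by rewrite /s; case: cid.
have wd X x x' : e X x = e X x' -> h X x = h X x'.
  move=> ee; apply/eqP; rewrite -subr_eq0 -raddfB; apply/eqP/hP.
  by rewrite raddfB ee subrr.
unshelve eexists (@nat_of _ G H (fun X y => h X (s X y)) _ _).
- by move=> X x y; rewrite -raddfD; apply: wd; rewrite raddfD !sP.
- by move=> X Y t y; rewrite -ncompP; apply: wd; rewrite ncompP !sP.
by move=> X x /=; apply: wd; rewrite sP.
Qed.

Lemma is_kernel_modf (F G N : M) (f : @hom M F G) (k : @hom M N F) :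
  (forall X, injective (k X) /\ exact_at (k X) (f X)) -> @is_kernel M _ _ f _ k.
Proof.
move=> kP; split=> [|W h /zero_morphismP h0].
  by apply/zero_morphismP => X x /=; apply/(proj2 (kP X)); exists x.
have [||u uP] := @nat_lift _ _ _ k h.
- by move=> X; case: (kP X).
- by move=> X x; apply/(proj2 (kP X))/h0.
exists u; split=> [|v e]; first by apply: nattrans_eq.
by apply: nattrans_eq => X x; apply: (proj1 (kP X)); rewrite uP -e.
Qed.

Lemma is_cokernel_modf (F G Q : M) (f : @hom M F G) (c : @hom M G Q) :
  (forall X, exact_at (f X) (c X) /\ surj (c X)) -> @is_cokernel M _ _ f _ c.
Proof.
move=> cP; split=> [|W h /zero_morphismP h0].
  by apply/zero_morphismP => X x /=; apply/(proj1 (cP X)); exists x.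
have [||u uP] := @nat_descend _ _ _ c h.
- by move=> X; case: (cP X).
- by move=> X x /(proj1 (cP X))[y <-]; apply: h0.
exists u; split=> [|v e]; first by apply: nattrans_eq.
by apply: nattrans_eq => X y; have [x <-] := proj2 (cP X) y; rewrite uP -e.
Qed.

Lemma biproduct_modf (F G : M) : exists (P : M),
  (exists (p : @hom M P F) (q : @hom M P G), @is_product M _ _ _ p q) /\
  (exists (i : @hom M F P) (j : @hom M G P), @is_coproduct M _ _ _ i j).
Proof.
exists (exist _ _ (prod_fp (svalP F) (svalP G))); split.
  unshelve eexists (@nat_of _ (prod_functor (sval F) (sval G)) (sval F)
    (fun X z => z.1) _ _); [by move=> X []|by move=> X Y t [] |].
  unshelve eexists (@nat_of _ (prod_functor (sval F) (sval G)) (sval G)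
    (fun X z => z.2) _ _); [by move=> X []|by move=> X Y t [] |].
  move=> W f g.
  unshelve eexists (@nat_of _ (sval W) (prod_functor (sval F) (sval G))
    (fun X w => (f X w, g X w)) _ _).
  - by move=> X x y; congr pair; apply: raddfD.
  - by move=> X Y t y /=; rewrite !ncompP.
  split=> [|h [<- <-]]; first by split; apply: nattrans_eq.
  by apply: nattrans_eq => X w /=; case: (h X w).
unshelve eexists (@nat_of _ (sval F) (prod_functor (sval F) (sval G))
  (fun X x => (x, 0)) _ _).
- by move=> X x y; congr pair; rewrite addr0.
- by move=> X Y t y /=; rewrite raddf0.
unshelve eexists (@nat_of _ (sval G) (prod_functor (sval F) (sval G))
  (fun X x => (0, x)) _ _).
- by move=> X x y; congr pair; rewrite addr0.
- by move=> X Y t y /=; rewrite raddf0.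
move=> W f g.
unshelve eexists (@nat_of _ (prod_functor (sval F) (sval G)) (sval W)
  (fun X z => f X z.1 + g X z.2) _ _).
- by move=> X [x x'] [y y']; rewrite /= !raddfD addrACA.
- by move=> X Y t y /=; rewrite raddfD !ncompP.
split=> [|h [<- <-]].
  by split; apply: nattrans_eq => X x /=; rewrite raddf0 ?addr0 ?add0r.
apply: nattrans_eq => X [x y] /=; rewrite -raddfD; congr (h X _).
by congr pair; rewrite ?addr0 ?add0r.
Qed.

Lemma abelian_modf : abelian M.
Proof.
split.
- exact: zero_object_modf.
- by split=> F G; have [P [? ?]] := biproduct_modf F G; exists P.
- split=> F G f.
    have [N [m [fpN mP]]] := kernel_functor f (svalP F) (svalP G).
    by exists (exist _ N fpN), m; apply: is_kernel_modf.
  have [Q [c [fpQ cP]]] := cokernel_functor f (svalP F) (svalP G).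
  by exists (exist _ Q fpQ), c; apply: is_cokernel_modf.
- move=> F G m /mono_modfP mi.
  have [Q [c [fpQ cP]]] := cokernel_functor m (svalP F) (svalP G).
  exists (exist _ Q fpQ), c; apply: is_kernel_modf => X; split=> //.
  by case: (cP X).
move=> F G e /epi_modfP es.
have [N [m [fpN mP]]] := kernel_functor e (svalP F) (svalP G).
exists (exist _ N fpN), m; apply: is_cokernel_modf => X; split=> //.
by case: (mP X).
Qed.

Definition repr_obj (X : A) : M := exist _ _ (representable_fp X).

Lemma repr_obj_projective X : @projective_object M (repr_obj X).
Proof.
move=> F G e f /epi_modfP es; have [z zP] := es X (f X (pidm X)).
exists (yoneda z); apply: nattrans_eq => Y t /=.
by rewrite ncompP zP -(nat_representable f).
Qed.

(* The obstruction to extending phi lies in Ext^1(G / F, Hom(-, X)), which the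
   weak cokernel property of weak kernels kills. *)
Lemma repr_obj_injective X : @injective_object M (repr_obj X).
Proof.
move=> F G m phi /mono_modfP mi.
have /finitely_presentedP[W1 [W0 [b [q qP]]]] := svalP F.
have /finitely_presentedP[X1 [X0 [a [p pP]]]] := svalP G.
have [w wP] := proj1 (pP W0) (m W0 q); pose u : phom W0 X := phi W0 q.
have [S [i1 [i2 [p1 [p2 [p1i1 p2i2 p1i2 p2i1 ip]]]]]] := biproducts W0 X1.
(* A pair in the weak kernel of [(w, a)] shows that a multiple of [m q] is a relation in [G]; as [m]
   is injective, the same multiple of [q] vanishes. *)
have [K [k [kP kC]]] := weak_kernels (pcomp w p1 + pcomp a p2).
have : pcomp (pcomp w p1 + pcomp a p2) k = 0.
  by apply/kP; exists (pidm K); apply: pcompm1.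
rewrite pcompDl -!pcompA => /eqP; rewrite addr_eq0 => /eqP wk.
have q0 : fmap (sval F) (pcomp p1 k) q = 0.
  apply: (mi K); rewrite raddf0 ncompP -wP -fmapM wk fmapN fmapM.
  by rewrite (presents_fmap pP) raddf0 oppr0.
(* Hence [u p1] kills [k] and factors through [(w, a)]; the factor [v] satisfies [v w = u] and
   [v a = 0], so it defines the extension. *)
have [v vP] : exists v, pcomp v (pcomp w p1 + pcomp a p2) = pcomp u p1.
  by apply/kC; rewrite -pcompA -[LHS](ncompP phi) q0 raddf0.
have vw : pcomp v w = u.
  have := congr1 (fun t => pcomp t i1) vP.
  by rewrite -!pcompA pcompDl -!pcompA p1i1 p2i1 !pcompm0 !pcompm1 addr0.
have va : pcomp v a = 0.
  have := congr1 (fun t => pcomp t i2) vP.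
  by rewrite -!pcompA pcompDl -!pcompA p1i2 p2i2 !pcompm0 !pcompm1 add0r.
have [psi psiP] := nat_of_presents (G := representable X) pP va.
exists psi; apply: (nat_presents_eq qP).
by rewrite /= -wP ncompP psiP /= /precomp vw.
Qed.

Lemma repr_obj_cover (F : M) : exists X (e : @hom M (repr_obj X) F),
  @epi M _ _ e.
Proof.
have /finitely_presentedP[X1 [X0 [a [x axP]]]] := svalP F.
by exists X0, (yoneda x); apply/epi_modfP => Y; case: (axP Y).
Qed.

(** The cokernel [F] of [Hom(-, a)] embeds in [Hom(-, Z)] through [g], because the morphisms [t]
    with [g t = 0] are precisely those that factor through [a]. *)
Lemma repr_obj_embedding (F : M) :
  exists X (m : @hom M F (repr_obj X)), @mono M _ _ m.
Proof.
have /finitely_presentedP[X1 [X0 [a [x axP]]]] := svalP F.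
have [Z [g gP]] := weak_kernel_of a.
have ga : pcomp g a = 0 by apply/gP; exists (pidm X1); apply: pcompm1.
have [m mP] := nat_of_presents (G := representable Z) axP ga.
exists Z, m; apply/mono_modfP => Y; apply: raddf_inj => y.
have [t <-] := proj1 (axP Y) y; rewrite ncompP mP => /gP[s <-].
by apply/(proj2 (axP Y)); exists s.
Qed.

Theorem frobenius_modf : frobenius M.
Proof.
split.
- exact: abelian_modf.
- move=> F; have [X [e eE]] := repr_obj_cover F.
  by exists (repr_obj X), e; split=> //; apply: repr_obj_projective.
- move=> F; have [X [m mM]] := repr_obj_embedding F.
  by exists (repr_obj X), m; split=> //; apply: repr_obj_injective.
(* A projective object is a retract of a representable functor and inherits injectivity from it; the
   last case is dual. *)
- move=> P Pp; have [X [e eE]] := repr_obj_cover P.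
  have [s sP] := Pp _ _ e (@idm M P) eE.
  move=> F G m f mM; have [g gP] := repr_obj_injective (@comp M _ _ _ s f) mM.
  by exists (@comp M _ _ _ e g); rewrite -comp_assoc gP comp_assoc sP comp_idl.
move=> I Ii; have [X [m mM]] := repr_obj_embedding I.
have [r rP] := Ii _ _ m (@idm M I) mM.
move=> F G e f eE; have [g gP] := repr_obj_projective (@comp M _ _ _ f r) eE.
by exists (@comp M _ _ _ g m); rewrite comp_assoc gP -comp_assoc rP comp_idr.
Qed.

End ModfFrobenius.

(** * Modules *)

Definition linear_of (R : pzRingType) (U V : lmodType R) (f : U -> V)
    (fl : linear f) : {linear U -> V} :=
  HB.pack f (GRing.isLinear.Build _ _ _ _ _ fl).

Section Modules.
Variable R : comPzRingType.
Implicit Types (U V W : lmodType R) (X Y Z : fgmod R).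

Section Pairing.
Variables (U V W : lmodType R) (f : {linear U -> V}) (g : {linear U -> W}).

Definition lpair (x : U) : V * W := (f x, g x).

Fact lpair_is_linear : linear lpair.
Proof. by move=> a x y; rewrite /lpair !linearP. Qed.
HB.instance Definition _ :=
  GRing.isLinear.Build R U (V * W)%type _ lpair lpair_is_linear.

End Pairing.

Lemma linear_inj U V (f : {linear U -> V}) :
  (forall x, f x = 0 -> x = 0) -> injective f.
Proof. exact: raddf_inj. Qed.

Lemma linear_factor_surj U V W (q : {linear U -> V}) (h : {linear U -> W}) :
  surj q -> (forall x, q x = 0 -> h x = 0) ->
  exists k : {linear V -> W}, forall x, k (q x) = h x.
Proof.
move=> qs qh; pose s y := sval (cid (qs y)).
have sP y : q (s y) = y by rewrite /s; case: cid.
have wd x x' : q x = q x' -> h x = h x'.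
  move=> e; apply/eqP; rewrite -subr_eq0 -linearB; apply/eqP/qh.
  by rewrite linearB /= e subrr.
have sl : linear (h \o s).
  by move=> a x y; rewrite /= -linearP; apply: wd; rewrite linearP !sP.
by exists (linear_of sl) => x; apply: wd; rewrite sP.
Qed.

Lemma linear_factor_inj U V W (i : {linear U -> V}) (h : {linear W -> V}) :
  injective i -> (forall x, exists y, i y = h x) ->
  exists k : {linear W -> U}, forall x, i (k x) = h x.
Proof.
move=> ii hi; pose k x := sval (cid (hi x)).
have kP x : i (k x) = h x by rewrite /k; case: cid.
have kl : linear k by move=> a x y; apply: ii; rewrite linearP !kP linearP.
by exists (linear_of kl).
Qed.

(** * Kernels and cokernels of linear maps *)

Section Kernel.
Variables (U V : lmodType R) (f : {linear U -> V}).

Definition in_kernel : {pred U} := fun x => f x == 0.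

Fact in_kernel_submod_closed : submod_closed in_kernel.
Proof.
split=> [|a x y /eqP x0 /eqP y0]; apply/eqP; first exact: raddf0.
by rewrite linearP x0 y0 scaler0 addr0.
Qed.
HB.instance Definition _ :=
  GRing.isSubmodClosed.Build R U in_kernel in_kernel_submod_closed.

Record kernel := Kernel { kernel_val : U; _ : kernel_val \in in_kernel }.
HB.instance Definition _ := [isSub for kernel_val].
HB.instance Definition _ := [Choice of kernel by <:].
HB.instance Definition _ := [SubChoice_isSubLmodule of kernel by <:].

End Kernel.

Section Cokernel.
Variables (U V : lmodType R) (f : {linear U -> V}).

Definition in_range : {pred V} := fun y => `[< exists x, f x = y >].

Fact in_range_zmod_closed : zmod_closed in_range.
Proof.
split=> [|y y' /asboolP[x <-] /asboolP[x' <-]]; apply/asboolP.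
  by exists 0; apply: raddf0.
by exists (x - x'); apply: raddfB.
Qed.
HB.instance Definition _ :=
  GRing.isZmodClosed.Build _ in_range in_range_zmod_closed.

Local Notation quot := (Quotient.quot in_range).

Definition cokernel : Type := quot.
HB.instance Definition _ := GRing.Zmodule.copy cokernel quot.

Definition cokernel_proj (y : V) : cokernel := \pi_quot y.

Fact cokernel_projP y y' :
  cokernel_proj y = cokernel_proj y' <-> exists x, f x = y - y'.
Proof.
rewrite (rwP (asboolP (exists _, _))).
rewrite -[`[< _ >]]/(y - y' \in in_range) Quotient.idealrBE.
exact: rwP eqP.
Qed.

Fact cokernel_projD y y' :
  cokernel_proj (y + y') = cokernel_proj y + cokernel_proj y'.
Proof. exact: (raddfD \pi_quot). Qed.

Fact cokernel_proj_surj : surj cokernel_proj.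
Proof. by move=> c; exists (repr (c : quot)); apply: reprK. Qed.

Definition cokernel_scale (a : R) (c : cokernel) : cokernel :=
  cokernel_proj (a *: repr (c : quot)).

Fact cokernel_scaleE a y :
  cokernel_scale a (cokernel_proj y) = cokernel_proj (a *: y).
Proof.
have /cokernel_projP[x xP] := reprK (cokernel_proj y : quot).
by apply/cokernel_projP; exists (a *: x); rewrite linearZ /= xP scalerBr.
Qed.

Fact cokernel_scaleA a b c :
  cokernel_scale a (cokernel_scale b c) = cokernel_scale (a * b) c.
Proof.
have [y <-] := cokernel_proj_surj c.
by rewrite !(cokernel_scaleE _ y) cokernel_scaleE scalerA.
Qed.

Fact cokernel_scale1 : left_id 1 cokernel_scale.
Proof.
by move=> c; have [y <-] := cokernel_proj_surj c;
  rewrite cokernel_scaleE scale1r.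
Qed.

Fact cokernel_scaleDr : right_distributive cokernel_scale +%R.
Proof.
move=> a c d; have [x <-] := cokernel_proj_surj c.
have [y <-] := cokernel_proj_surj d.
by rewrite -cokernel_projD !cokernel_scaleE scalerDr cokernel_projD.
Qed.

Fact cokernel_scaleDl c : {morph cokernel_scale^~ c : a b / a + b}.
Proof.
move=> a b; have [y <-] := cokernel_proj_surj c.
by rewrite !cokernel_scaleE scalerDl cokernel_projD.
Qed.
HB.instance Definition _ :=
  GRing.Zmodule_isLmodule.Build R cokernel cokernel_scaleA cokernel_scale1
    cokernel_scaleDr cokernel_scaleDl.

Lemma cokernel_exists : exists (Q : lmodType R) (p : {linear V -> Q}),
  exact_at f p /\ surj p.
Proof.
have pl : linear (cokernel_proj : V -> cokernel).
  by move=> a x y; rewrite cokernel_projD -cokernel_scaleE.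
exists cokernel, (linear_of pl); split=> [y|]; last exact: cokernel_proj_surj.
have p0 : cokernel_proj 0 = 0 by apply: (raddf0 \pi_quot).
by rewrite /= -p0 cokernel_projP subr0.
Qed.

End Cokernel.

(** * Finitely generated and free modules *)

Lemma fg_surj U V (f : {linear U -> V}) :
  surj f -> finitely_generated U -> finitely_generated V.
Proof.
move=> fs [n [e eP]]; exists n, (f \o e) => y; have [x <-] := fs y.
have [c ->] := eP x; exists c; rewrite linear_sum.
by apply: eq_bigr => i _; rewrite linearZ.
Qed.

Lemma fg_cokernel U Y (f : {linear U -> Y}) :
  exists Z (p : {linear Y -> Z}), exact_at f p /\ surj p.
Proof.
have [Q [p [pe ps]]] := cokernel_exists f.
by exists (FgMod (fg_surj ps (fgmodP Y))), p.
Qed.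

Definition lcomb n U (e : 'I_n -> U) (v : 'rV[R]_n) : U := \sum_i v 0 i *: e i.

Fact lcomb_is_linear n U (e : 'I_n -> U) : linear (lcomb e).
Proof.
move=> a v w; rewrite /lcomb scaler_sumr -big_split; apply: eq_bigr => i _ /=.
by rewrite !mxE scalerDl scalerA.
Qed.
HB.instance Definition _ n U (e : 'I_n -> U) :=
  GRing.isLinear.Build R _ _ _ (lcomb e) (lcomb_is_linear e).

Lemma lcomb_row n U (e : 'I_n -> U) (c : 'I_n -> R) :
  lcomb e (\row_i c i) = \sum_i c i *: e i.
Proof. by apply: eq_bigr => i _; rewrite mxE. Qed.

Lemma linear_row n U (f : {linear 'rV[R]_n -> U}) v :
  f v = lcomb (fun i => f (delta_mx 0 i)) v.
Proof.
rewrite {1}[v]row_sum_delta linear_sum; by apply: eq_bigr => i _;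
  rewrite linearZ.
Qed.

Lemma free_fg n : finitely_generated 'rV[R]_n.
Proof.
exists n, (fun i => delta_mx 0 i) => v; exists (fun i => v 0 i).
exact: row_sum_delta.
Qed.
Definition free n : fgmod R := FgMod (free_fg n).

Lemma free_projective n : projective (free n).
Proof.
move=> U V g f gs; pose e i := sval (cid (gs (f (delta_mx 0 i)))).
have eP i : g (e i) = f (delta_mx 0 i) by rewrite /e; case: cid.
exists (lcomb e) => v; rewrite [RHS]linear_row linear_sum.
by apply: eq_bigr => i _; rewrite linearZ /= eP.
Qed.

Lemma free_cover X : exists n (g : {linear free n -> X}), surj g.
Proof.
have [n [e eP]] := fgmodP X; exists n, (lcomb e) => x; have [c ->] := eP x.
by exists (\row_i c i); apply: lcomb_row.
Qed.

End Modules.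

(** * Finitely generated modules over a Noetherian ring *)

Section Noetherian.
Variable R : comPzRingType.
Implicit Types (U V W : lmodType R) (X Y Z K E P Q : fgmod R).
Hypothesis noethR : noetherian R.

(** Induction on the number of generators: the coefficients of [e ord0] in elements of [S] form a
    finitely generated ideal, and subtracting suitable elements of [S] leaves the part of [S]
    spanned by the other generators. *)
Lemma submodule_generated n U (e : 'I_n -> U) (S : U -> Prop) :
    S 0 -> (forall x y, S x -> S y -> S (x + y)) ->
    (forall a x, S x -> S (a *: x)) ->
    (forall x, S x -> exists v, x = lcomb e v) ->
  exists m (f : {linear 'rV[R]_m -> U}), forall x, S x <-> exists v, f v = x.
Proof.
elim: n e S => [|n IHn] e S S0 SD SZ Se.
  exists 0, \0 => x; split=> [/Se[v ->]|[v <-]] //=.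
  by exists 0; rewrite /lcomb big_ord0.
pose e' i := e (lift ord0 i).
have eE v : lcomb e v = v 0 ord0 *: e ord0 + lcomb e' (\row_i v 0 (lift ord0
  i)).
  by rewrite lcomb_row /lcomb big_ord_recl.
pose I a := exists w, S (a *: e ord0 + lcomb e' w).
have [|||k [g [gI gP]]] := noethR (I := I).
- by exists 0; rewrite scale0r raddf0 addr0.
- by move=> a b [v av] [w bw]; exists (v + w); rewrite scalerDl raddfD addrACA;
  apply: SD.
- by move=> a b [v bv]; exists (a *: v);
  rewrite -scalerA [lcomb _ _]linearZ -scalerDr; apply: SZ.
have [w wP] := choice gI.
pose s i := g i *: e ord0 + lcomb e' (w i).
have Ss (c : 'rV_k) : S (lcomb s c).
  by rewrite /lcomb; elim/big_ind: _ => // i _; apply/SZ/wP.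
have [||||m [f fP]] := IHn e' (fun x => S x /\ exists v, x = lcomb e' v).
- by split=> //; exists 0; rewrite raddf0.
- move=> x y [Sx [v xE]] [Sy [v' yE]]; split; first exact: SD.
  by exists (v + v'); rewrite raddfD xE yE.
- move=> a x [Sx [v xE]]; split; first exact: SZ.
  by exists (a *: v); rewrite linearZ xE.
- by move=> x [].
exists (m + k)%N, ((f \o lsubmx) \+ (lcomb s \o rsubmx)) => x; split;
  last first.
  by case=> v <- /=; apply: SD => //; apply: (proj1 (proj2 (fP _) _));
    exists (lsubmx v).
move=> Sx; have [v xE] := Se x Sx; rewrite eE in xE.
have [|c cP] := gP (v 0 ord0).
  by exists (\row_i v 0 (lift ord0 i)); rewrite -xE.
have sE : lcomb s (\row_i c i) =
    (\sum_i c i * g i) *: e ord0 + lcomb e' (\sum_i c i *: w i).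
  rewrite lcomb_row linear_sum scaler_suml -big_split.
  by apply: eq_bigr => i _; rewrite linearZ scalerDr scalerA.
have [|u uP] := proj1 (fP (x - lcomb s (\row_i c i))).
  split; first by rewrite -scaleN1r; apply: SD => //; apply: SZ.
  exists (\row_i v 0 (lift ord0 i) - \sum_i c i *: w i).
  by rewrite sE xE cP linearB opprD addrACA addrN add0r.
by exists (row_mx u (\row_i c i)); rewrite /= row_mxKl row_mxKr uP subrK.
Qed.

Lemma fg_kernel X V (f : {linear X -> V}) :
  exists K (i : {linear K -> X}), injective i /\ exact_at i f.
Proof.
have [n [e eP]] := fgmodP X.
have [||||m [g gP]] := @submodule_generated _ _ e (fun x => f x = 0).
- exact: raddf0.
- by move=> x y x0 y0; rewrite raddfD /= x0 y0 addr0.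
- by move=> a x x0; rewrite linearZ /= x0 scaler0.
- by move=> x _; have [c ->] := eP x; exists (\row_i c i); rewrite lcomb_row.
have vl : linear (val : kernel f -> X) by [].
pose i := linear_of vl; have iP : exact_at i f.
  move=> x; split=> [/eqP x0|[[y /eqP y0] <-]] //.
  by exists (Kernel (x0 : x \in in_kernel f)).
have [|v|k kP] := @linear_factor_inj _ _ _ _ i g; first exact: val_inj.
  by apply/iP/gP; exists v.
have ks : surj k.
  move=> x; have /iP/gP[v vP] : exists y, i y = i x by exists x.
  by exists v; apply: val_inj; exact: etrans (kP v) vP.
exists (FgMod (fg_surj ks (free_fg R m))), i; split=> //; exact: val_inj.
Qed.

Lemma kernel_short_exact X Y (f : {linear X -> Y}) : surj f ->
  exists K (i : {linear K -> X}), short_exact i f.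
Proof. by move=> fs; have [K [i [ii ie]]] := fg_kernel f; exists K, i. Qed.

Lemma syzygy_exists X : exists n K (i : {linear K -> free R n}) p,
  @short_exact R K (free R n) X i p.
Proof.
have [n [p ps]] := free_cover X; have [K [i ip]] := kernel_short_exact ps.
by exists n, K, i, p.
Qed.

(** The kernel of [f x - g y] on the direct sum. Its universal property is recorded on elements:
    lifts exist, and the two projections are jointly injective. *)
Lemma pullback_exists X Y Z (f : {linear X -> Z}) (g : {linear Y -> Z}) :
  exists E (p : {linear E -> X}) (q : {linear E -> Y}),
    [/\ forall z, f (p z) = g (q z),
        forall x y, f x = g y -> exists z, p z = x /\ q z = y
      & forall z, p z = 0 -> q z = 0 -> z = 0].
Proof.
have [E [i [ii ie]]] := @fg_kernel (dsum X Y) _ ((f \o fst) \- (g \o snd)).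
exists E, (fst \o i), (snd \o i); split=> [z|x y fg|z] /=.
- by apply/eqP; rewrite -subr_eq0; apply/eqP/(ie (i z)); exists z.
- have /ie[z zE] : ((f \o fst) \- (g \o snd)) (x, y) = 0 by rewrite /= fg subrr.
  by exists z; rewrite zE.
by move=> p0 q0; apply: ii; rewrite raddf0 [LHS]surjective_pairing p0 q0.
Qed.

(* The kernel of either projection of a pullback is the kernel of the opposite
   side of the square. *)
Lemma pullback_short_exact K X Y Z (i : {linear K -> Y}) (f : {linear X -> Z})
    (g : {linear Y -> Z}) E (p : {linear E -> X}) (q : {linear E -> Y}) :
    short_exact i g ->
    (forall z, f (p z) = g (q z)) ->
    (forall x y, f x = g y -> exists z, p z = x /\ q z = y) ->
    (forall z, p z = 0 -> q z = 0 -> z = 0) ->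
  exists j : {linear K -> E}, short_exact j p /\ forall k, q (j k) = i k.
Proof.
move=> [ii ie gs] pq pqs pq0.
have qi : {in [pred z | p z == 0] &, injective q}.
  move=> z z' /eqP pz /eqP pz' e; apply/eqP; rewrite -subr_eq0; apply/eqP.
  by apply: pq0; rewrite raddfB /= ?pz ?pz' ?e subrr.
have lift k : exists z, p z = 0 /\ q z = i k.
  by apply: pqs; rewrite raddf0; apply/esym/ie; exists k.
have [j jP] := choice lift.
have jl : linear j.
  move=> a x y; apply: qi; rewrite ?inE ?linearP /= ?(proj1 (jP _)) //.
    by rewrite scaler0 addr0.
  by rewrite !(proj2 (jP _)) linearP.
exists (linear_of jl); split=> [|k]; last exact: (proj2 (jP k)).
split=> [x y /= e|z|x].
- by apply: ii; rewrite -!(proj2 (jP _)) e.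
- split=> [pz|[k <-]]; last exact: (proj1 (jP k)).
  have /ie[k kP] : g (q z) = 0 by rewrite -pq pz raddf0.
  exists k; apply: qi; rewrite ?inE ?pz ?(proj1 (jP k)) //.
  by rewrite (proj2 (jP k)).
by have [y yP] := gs (f x); have [//|z [<- _]] := pqs x y; exists z.
Qed.

End Noetherian.

(** * Short exact sequences *)

Section ShortExact.
Variable R : comPzRingType.
Implicit Types (U V W : lmodType R).

Lemma short_exact0 U V W (f : {linear U -> V}) (g : {linear V -> W}) :
  short_exact f g -> forall x, g (f x) = 0.
Proof. by case=> _ fg _ x; apply/fg; exists x. Qed.

Lemma projective_split U V W (f : {linear U -> V}) (g : {linear V -> W}) :
  short_exact f g -> projective W ->
  exists r : {linear V -> U}, forall x, r (f x) = x.
Proof.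
move=> fg; have [fi fge gs] := fg => /(_ _ _ g idfun gs)[t tP].
have [|x|r rP] := @linear_factor_inj _ _ _ _ f (idfun \- (t \o g)) => //.
  by apply/fge; rewrite raddfB /= tP subrr.
by exists r => x; apply: fi; rewrite rP /= (short_exact0 fg) raddf0 subr0.
Qed.

End ShortExact.

(** * Vanishing of Ext(-, R) by dimension shifting *)

Section ExtVanishing.
Variable R : comPzRingType.
Implicit Types (U V W : lmodType R) (X Y Z K L M N E P Q : fgmod R).

(** Surjectivity of [V* -> U*]. For an injective [i] with projective [V] and cokernel [Z] this
    amounts to [Ext^1(Z, R) = 0]. *)
Definition functionals_extend U V (i : {linear U -> V}) : Prop :=
  forall phi : {linear U -> R^o},
    exists psi : {linear V -> R^o}, forall x, psi (i x) = phi x.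

(* Ext^{n+1}(X, R) = 0. *)
Fixpoint ext_zero n X : Prop :=
  match n with
  | 0 => forall K E (i : {linear K -> E}) (p : {linear E -> X}),
           short_exact i p -> functionals_extend i
  | m.+1 => forall K P (i : {linear K -> P}) (p : {linear P -> X}),
           projective P -> short_exact i p -> ext_zero m K
  end.

Hypothesis noethR : noetherian R.

(** For [n = 0] an extension of [X] is pulled back along [r] to one of [Y], and [s] gives a map
    back. In higher degrees a syzygy of [X] is made a retract of a syzygy of [Y]. *)
Lemma ext_zero_retract n X Y (s : {linear X -> Y}) (r : {linear Y -> X}) :
  (forall x, r (s x) = x) -> ext_zero n Y -> ext_zero n X.
Proof.
elim: n X Y s r => [|n IHn] X Y s r rs.
  move=> Y0 K E i p ip phi; have [ii ie ps] := ip.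
  have [M [a [b [ab abs ab0]]]] := pullback_exists noethR r p.
  have [j [ja bj]] := pullback_short_exact ip ab abs ab0.
  have [psi psiP] := Y0 _ _ _ _ ja phi.
  have lpi : injective (lpair a b).
    by apply: linear_inj => z [az bz]; apply: ab0.
  have [e|t tP] := @linear_factor_inj _ _ _ _ _ (lpair (s \o p) idfun) lpi.
    by have [|z [az bz]] := abs (s (p e)) e; [rewrite rs | exists z;
      rewrite /= /lpair az bz].
  exists (psi \o t) => k; rewrite /= -psiP; congr (psi _); apply: lpi.
  by rewrite tP /= /lpair /= bj (short_exact0 ip) (short_exact0 ja) raddf0.
move=> Yn K P i p hP ip; have [ii ie ps] := ip.
have [m [a as_]] := free_cover Y.
(* The second summand uses the idempotent [1 - s r], so that [r h] is [p] on the first component and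
   the first projection takes the kernel of [h] back to [K]. *)
pose h : {linear dsum P (free R m) -> Y} :=
  (s \o p \o fst) \+ ((a \o snd) \- (s \o r \o a \o snd)).
have hs : surj h.
  move=> y; have [x xP] := ps (r y); have [v vP] := as_ y; exists (x, v).
  by rewrite /= xP vP addrC subrK.
have [N [j jh]] := kernel_short_exact noethR hs; have [ji jhe _] := jh.
have Nn : ext_zero n N by apply: (Yn) jh;
  apply: projective_prod hP (@free_projective R m).
have [k|sg sgP] := @linear_factor_inj _ _ _ _ j (lpair i \0 : {linear K ->
  dsum P (free R m)}) ji.
  by apply/jhe; rewrite /= (short_exact0 ip) !raddf0 !addr0.
have [z|rh rhP] := @linear_factor_inj _ _ _ _ i (fst \o j) ii.
  apply/ie; have := congr1 r (short_exact0 jh z).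
  by rewrite /= raddf0 raddfD raddfB /= !rs subrr addr0.
by apply: (IHn _ _ sg rh) Nn => k; apply: ii; rewrite rhP /= sgP.
Qed.

Lemma ext_zero_projective n P : projective P -> ext_zero n P.
Proof.
elim: n P => [|n IHn] P hP.
  move=> K E i p ip phi; have [r rP] := projective_split ip hP.
  by exists (phi \o r) => k /=; rewrite rP.
move=> K Q i p hQ ip; have [r rP] := projective_split ip hP.
by apply: ext_zero_retract rP _; apply: IHn.
Qed.

(** [L] is the preimage of [X] in [E]: a surjection onto [Y] with kernel [K] yields one from [L]
    onto [X] with the same kernel. *)
Lemma short_exact_preimage X Y Z (f : {linear X -> Y}) (g : {linear Y -> Z})
    K E (i : {linear K -> E}) (p : {linear E -> Y}) :
  short_exact f g -> short_exact i p ->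
  exists L (j : {linear L -> E}) (i' : {linear K -> L}) (p' : {linear L -> X}),
    [/\ short_exact j (g \o p), short_exact i' p' & forall k, j (i' k) = i k].
Proof.
move=> fg ip; have [fi fe gs] := fg; have [ii ie ps] := ip.
have [|L [j jgp]] := @kernel_short_exact _ noethR _ _ (g \o p).
  by move=> z; have [y <-] := gs z; have [x <-] := ps y; exists x.
have [ji je _] := jgp.
have [k|i' i'P] := @linear_factor_inj _ _ _ _ j i ji.
  by apply/je; rewrite /= (short_exact0 ip) raddf0.
have [l|p' p'P] := @linear_factor_inj _ _ _ _ f (p \o j) fi.
  by apply/fe; apply: (short_exact0 jgp).
exists L, j, i', p'; split=> //; split.
- by move=> k k' e; apply: ii; rewrite -!i'P e.
- move=> l; split=> [l0|[k <-]].
    have /ie[k kP] : p (j l) = 0 by rewrite -[LHS]p'P l0 raddf0.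
    by exists k; apply: ji; rewrite i'P.
  by apply: fi; rewrite p'P /= i'P (short_exact0 ip) raddf0.
move=> x; have [e eP] := ps (f x).
have /je[l lP] : (g \o p) e = 0 by rewrite /= eP (short_exact0 fg).
by exists l; apply: fi; rewrite p'P /= lP.
Qed.

(** The pullback [M] is at once an extension of [Y] by [K] and of [E] by [X]; several dimension
    shifts below compare these two descriptions. *)
Lemma pullback_of_short_exact X Y Z (f : {linear X -> Y}) (g : {linear Y -> Z})
    K E (i : {linear K -> E}) (p : {linear E -> Z}) :
  short_exact f g -> short_exact i p ->
  exists M (a : {linear M -> Y}) (b : {linear M -> E})
         (v : {linear K -> M}) (u : {linear X -> M}),
    (short_exact v a /\ forall k, b (v k) = i k) /\
    (short_exact u b /\ forall x, a (u x) = f x).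
Proof.
move=> fg ip; have [M [a [b [ab abs ab0]]]] := pullback_exists noethR g p.
have [v vP] := pullback_short_exact ip ab abs ab0.
have [z|e y pe|z bz az|u uP] := @pullback_short_exact _ _ _ _ _ f p g M b a fg.
- by rewrite ab.
- by have [|z [? ?]] := abs y e; [|exists z].
- exact: ab0.
by exists M, a, b, v, u.
Qed.

Section Sequence.
Variables (X Y Z : fgmod R) (f : {linear X -> Y}) (g : {linear Y -> Z}).
Hypothesis fg : short_exact f g.

Lemma ext_zero_extension0 : ext_zero 0 X -> ext_zero 0 Z -> ext_zero 0 Y.
Proof.
move=> X0 Z0 K E i p ip phi.
have [L [j [i' [p' [jgp i'p' ji']]]]] := short_exact_preimage fg ip.
have [psi psiP] := X0 _ _ _ _ i'p' phi.
have [chi chiP] := Z0 _ _ _ _ jgp psi.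
by exists chi => k; rewrite -ji' chiP psiP.
Qed.

Lemma ext_zero_cokernel0 : functionals_extend f -> ext_zero 0 Y -> ext_zero 0 Z.
Proof.
move=> fext Y0 K E i p ip phi.
have [M [a [b [v [u [[va bv] [ub au]]]]]]] := pullback_of_short_exact fg ip.
have [psi psiP] := Y0 _ _ _ _ va phi.
have [chi chiP] := fext (psi \o u).
(* Subtracting [chi a] makes the extension vanish on [X] without changing it on [K], so it descends
   to [E]. *)
have [|z bz|om omP] := @linear_factor_surj _ _ _ _ b (psi \- (chi \o a)).
- by case: ub.
- have [_ ube _] := ub; have /ube[x <-] := bz.
  by rewrite /= au chiP subrr.
by exists om => k; rewrite -bv omP /= psiP (short_exact0 va) raddf0 subr0.
Qed.

End Sequence.

(* The pullback of Y -> Z along a free cover of Z is an extension of Y by the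
   syzygy of Z, and X is a direct summand of it. *)
Lemma ext_zero_kernel_of_extension n :
  (forall X Y Z (f : {linear X -> Y}) (g : {linear Y -> Z}),
    short_exact f g -> ext_zero n X -> ext_zero n Z -> ext_zero n Y) ->
  forall X Y Z (f : {linear X -> Y}) (g : {linear Y -> Z}),
    short_exact f g -> ext_zero n Y -> ext_zero n.+1 Z -> ext_zero n X.
Proof.
move=> extn X Y Z f g fg Yn Zn.
have [m [K [i [p ip]]]] := syzygy_exists noethR Z.
have [M [a [b [v [u [[va _] [ub _]]]]]]] := pullback_of_short_exact fg ip.
have [r rP] := projective_split ub (@free_projective R m).
apply: ext_zero_retract rP _; apply: extn va _ Yn.
exact: Zn (@free_projective R m) ip.
Qed.

(** Extensions in degree [n.+1] reduce to kernels in degree [n]: [L] is a syzygy of [Z], and [K] is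
    the kernel of [L -> X]. *)
Lemma ext_zero_extension n X Y Z (f : {linear X -> Y}) (g : {linear Y -> Z}) :
  short_exact f g -> ext_zero n X -> ext_zero n Z -> ext_zero n Y.
Proof.
elim: n X Y Z f g => [|n IHn] X Y Z f g fg; first exact: ext_zero_extension0 fg.
move=> Xn Zn K P i p hP ip.
have [L [j [i' [p' [jgp i'p' _]]]]] := short_exact_preimage fg ip.
apply: (ext_zero_kernel_of_extension IHn i'p') => //; exact: Zn jgp.
Qed.

Lemma ext_zero_kernel n X Y Z (f : {linear X -> Y}) (g : {linear Y -> Z}) :
  short_exact f g -> ext_zero n Y -> ext_zero n.+1 Z -> ext_zero n X.
Proof. exact/ext_zero_kernel_of_extension/ext_zero_extension. Qed.

(** With [P] projective, [M] is an extension of [P] by [X] and so has the vanishing for [n]; the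
    syzygy [K] of [Z] is the kernel of [M -> Y]. *)
Lemma ext_zero_cokernel n X Y Z (f : {linear X -> Y}) (g : {linear Y -> Z}) :
  short_exact f g -> ext_zero n X -> ext_zero n.+1 Y -> ext_zero n.+1 Z.
Proof.
move=> fg Xn Yn K P i p hP ip.
have [M [a [b [v [u [[va _] [ub _]]]]]]] := pullback_of_short_exact fg ip.
apply: (ext_zero_kernel va) Yn; apply: (ext_zero_extension ub Xn).
exact: ext_zero_projective.
Qed.

(** * Comparison with Ext computed from resolutions *)

Lemma ext_classes_zeroP X (P : resolution X) n :
  (forall c : Ext P R^o n.+1, c = 0) <->
  forall f : {linear rterm P n.+1 -> R^o}, (forall x, f (rdiff P n.+1 x) = 0) ->
    exists g : {linear rterm P n -> R^o}, forall x, g (rdiff P n x) = f x.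
Proof.
pose quot := Quotient.quot (@is_coboundary _ X P R^o n.+1).
have pi0 (c : cocycle P R^o n.+1) : \pi_quot c = 0 <->
    exists g : {linear rterm P n -> R^o}, forall x, g (rdiff P n x) = val c x.
  rewrite -(raddf0 \pi_quot).
  have -> : (\pi_quot c = \pi_quot 0) <-> (c - 0 \in @is_coboundary _ X P R^o
    n.+1).
    by rewrite Quotient.idealrBE; split=> [/eqP|/eqP].
  rewrite subr0; split=> [/asboolP[g gP]|[g gP]]; first by exists g => x;
    rewrite gP.
  by apply/asboolP; exists g; apply: linear_eq => x; rewrite /= gP.
split=> [E0 f f0|fP c]; last first.
  rewrite -[c]reprK; apply/pi0; apply: fP => x.
  by case: (repr _) => f f0 /=; move/eqP: (f0) => e;
    rewrite -[RHS](congr1 (fun h : {linear _ -> _} => h x) e).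
have fc : f \in @is_cocycle _ X P R^o n.+1 by apply/eqP/linear_eq.
exact: (proj1 (pi0 (Cocycle fc)) (E0 _)).
Qed.

Lemma resolution_syzygy X (P : resolution X) :
  exists Z (i : {linear Z -> rterm P 0}) (d : {linear rterm P 1 -> Z}),
    [/\ short_exact i (raug P), surj d, exact_at (rdiff P 1) d
      & forall x, i (d x) = rdiff P 0 x].
Proof.
have [Z [i ia]] := kernel_short_exact noethR (@raug_surj _ _ P).
have [ii ie _] := ia.
have [x|d dP] := @linear_factor_inj _ _ _ _ i (rdiff P 0) ii.
  by apply/ie/raug_exact; exists x.
exists Z, i, d; split=> // x.
  have /raug_exact[y yP] := short_exact0 ia x.
  by exists y; apply: ii; rewrite dP.
rewrite -rdiff_exact -dP; split=> [->|e]; first exact: raddf0.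
by apply: ii; rewrite e raddf0.
Qed.

(** Induction along the shifted resolution of the first syzygy; as [ext_zero] does not mention [P],
    the vanishing is independent of the resolution. *)
Lemma ext_classes_zeroE n X (P : resolution X) :
  (forall c : Ext P R^o n.+1, c = 0) <-> ext_zero n X.
Proof.
rewrite ext_classes_zeroP; elim: n X P => [|n IHn] X P.
  have [Z [i [d [ia ds d0 dP]]]] := resolution_syzygy P.
  split=> [PE|X0 f f0].
    apply: (ext_zero_cokernel0 ia);
      last by apply/ext_zero_projective/rterm_projective.
    move=> phi; have [|g gP] := PE (phi \o d).
      by move=> x /=; rewrite (proj2 (d0 _)) ?raddf0 //; exists x.
    by exists g => z; have [x <-] := ds z; rewrite dP gP.
  have [x|phi phiP] := @linear_factor_surj _ _ _ _ d f ds.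
    by move=> /d0[y <-].
  by have [g gP] := X0 _ _ _ _ ia phi; exists g => x; rewrite -dP gP phiP.
have [Z [i [d [ia ds d0 _]]]] := resolution_syzygy P.
pose P' := @Resolution R Z _ _ d (fun k => @rterm_projective _ _ P k.+1) ds d0
  (fun k => @rdiff_exact _ _ P k.+1).
rewrite (IHn Z P'); split=> [Zn|Xn];
  last exact: (Xn _ _ _ _ (@rterm_projective _ _ P 0) ia).
by apply: (ext_zero_cokernel ia Zn); apply/ext_zero_projective/rterm_projective.
Qed.

Lemma resolution_exists X : inhabited (resolution X).
Proof.
(* A sigma type rather than an existential, so that syzygies can be iterated into the data of a
   resolution. *)
have h Y : {n & {K : fgmod R & {i : {linear K -> free R n} &
    {p : {linear free R n -> Y} | short_exact i p}}}}.
  have [n /cid[K /cid[i /cid p]]] := cid (syzygy_exists noethR Y).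
  by exists n, K, i.
pose n Y := projT1 (h Y); pose S Y := projT1 (projT2 (h Y)).
pose i Y : {linear S Y -> free R (n Y)} := projT1 (projT2 (projT2 (h Y))).
pose p Y : {linear free R (n Y) -> Y} := sval (projT2 (projT2 (projT2 (h Y)))).
have ip Y : short_exact (i Y) (p Y) := svalP (projT2 (projT2 (projT2 (h Y)))).
pose T k := iter k S X.
have is' k : exact_at (i (T k) \o p (T k.+1)) (p (T k)).
  move=> x; have [_ pe _] := ip (T k); rewrite pe.
  have [_ _ ps] := ip (T k.+1); split=> [[y <-]|[y <-]].
    by have [z <-] := ps y; exists z.
  by exists (p _ y).
constructor; apply: (@Resolution R X (fun k => free R (n (T k)))
  (fun k => i (T k) \o p (T k.+1)) (p X)) => [k|||k x].
- exact: free_projective.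
- by case: (ip X).
- exact: (is' 0).
rewrite -(is' k.+1 x); split=> [/= e|/= ->]; last exact: raddf0.
by have [ii _ _] := ip (T k); apply: ii; rewrite e raddf0.
Qed.

Lemma Ext_vanishesP n X : Ext_vanishes X R^o n.+1 <-> ext_zero n X.
Proof.
split=> [[P]|Xn]; first by rewrite ext_classes_zeroE.
by have [P] := resolution_exists X; exists P; rewrite ext_classes_zeroE.
Qed.

Lemma catHP X : catH X <-> forall n, ext_zero n X.
Proof.
split=> [HX n|HX [//|n] _]; first exact/Ext_vanishesP/HX.
by apply/Ext_vanishesP.
Qed.

End ExtVanishing.

(** * Duality and transposes *)

Section Duality.
Variable R : comPzRingType.
Implicit Types (U V W : lmodType R) (X Y Z T K L M N E P Q : fgmod R).

Definition dual U : lmodType R := {linear U -> R^o}.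

Definition lrow U n (xi : 'I_n -> dual U) (x : U) : 'rV[R]_n := \row_k xi k x.

Fact lrow_is_linear U n (xi : 'I_n -> dual U) : linear (lrow xi).
Proof. by move=> a x y; apply/rowP => k; rewrite !mxE linearP. Qed.
HB.instance Definition _ U n (xi : 'I_n -> dual U) :=
  GRing.isLinear.Build R _ _ _ (lrow xi) (lrow_is_linear xi).

(** Dual basis lemma: the functionals [s] are the coordinates of a section of a free cover, whose
    basis maps to [e]. *)
Lemma dual_basis P : projective P ->
  exists n (e : 'I_n -> P) (s : 'I_n ->
    dual P), forall x, lcomb e (lrow s x) = x.
Proof.
move=> hP; have [n [g gs]] := free_cover P.
have [t tP] := hP _ _ g idfun gs.
have sl k : linear (fun x => t x 0 k : R^o).
  by move=> a x y; rewrite linearP !mxE.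
exists n, (fun k => g (delta_mx 0 k)), (fun k => linear_of (sl k)) => x.
rewrite -[RHS]tP [RHS]linear_row; congr lcomb.
by apply/rowP => k; rewrite mxE.
Qed.

Lemma linear_lcomb U V n (e : 'I_n -> U) (f : {linear U -> V}) v :
  f (lcomb e v) = \sum_i v 0 i *: f (e i).
Proof. by rewrite linear_sum; apply: eq_bigr => i _; rewrite linearZ. Qed.

Lemma sum_linearE U V n (f : 'I_n -> {linear U -> V}) x :
  (\sum_i f i) x = \sum_i f i x.
Proof. by elim/big_rec2: _ => // i _ g _ <-. Qed.

Lemma dual_basis_dual n P (e : 'I_n -> P) (s : 'I_n -> dual P) :
  (forall x, lcomb e (lrow s x) = x) ->
  forall xi : dual P, xi = \sum_i xi (e i) *: s i.
Proof.
move=> es xi; apply: linear_eq => x.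
rewrite sum_linearE -{1}[x]es linear_lcomb; apply: eq_bigr => i _.
by rewrite mxE; apply: mulrC.
Qed.

Lemma dual_fg P : projective P -> finitely_generated (dual P).
Proof.
case/dual_basis=> n [e [s es]]; exists n, s => xi.
by exists (fun i => xi (e i)); apply: dual_basis_dual.
Qed.

Lemma dual_projective P : projective P -> projective (dual P).
Proof.
case/dual_basis=> n [e [s es]] U V g f gs.
pose u i := sval (cid (gs (f (s i)))).
have uP i : g (u i) = f (s i) by rewrite /u; case: cid.
have hl : linear (fun xi : dual P => lcomb u (\row_i xi (e i))).
  by move=> a x y; rewrite -linearP; congr lcomb; apply/rowP => i; rewrite !mxE.
exists (linear_of hl) => xi; rewrite /= linear_lcomb.
rewrite [in RHS](dual_basis_dual es xi) linear_sum; apply: eq_bigr => i _.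
by rewrite mxE uP linearZ.
Qed.

Lemma projective_reflexive P (phi : {linear dual P -> R^o}) : projective P ->
  exists y, forall xi : dual P, phi xi = xi y.
Proof.
case/dual_basis=> n [e [s es]]; exists (lcomb e (\row_i phi (s i))) => xi.
rewrite linear_lcomb [in LHS](dual_basis_dual es xi) linear_sum.
by apply: eq_bigr => i _; rewrite mxE linearZ; apply: mulrC.
Qed.

Lemma projective_torsionless P (y : P) : projective P ->
  (forall xi : dual P, xi y = 0) -> y = 0.
Proof.
case/dual_basis=> n [e [s es]] y0; rewrite -[y]es.
by apply: big1 => i _; rewrite mxE y0 scale0r.
Qed.

Lemma maps_extend U V Q (f : {linear U -> V}) (phi : {linear U -> Q}) :
  functionals_extend f -> projective Q ->
  exists psi : {linear V -> Q}, forall x, psi (f x) = phi x.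
Proof.
move=> fext /dual_basis[n [e [s es]]].
have [psi psiP] := choice (fun i => fext (s i \o phi)).
exists (lcomb e \o lrow psi) => x; rewrite -[RHS]es; congr lcomb.
by apply/rowP => i; rewrite !mxE psiP.
Qed.

Definition evaluation U (x : U) (xi : dual U) : R^o := xi x.

Fact evaluation_is_linear U (x : U) : linear (evaluation x).
Proof. by []. Qed.
HB.instance Definition _ U (x : U) :=
  GRing.isLinear.Build R _ _ _ (evaluation x) (evaluation_is_linear x).

Definition dual_map U V (d : {linear U -> V}) (xi : dual V) : dual U := xi \o d.

Fact dual_map_is_linear U V (d : {linear U -> V}) : linear (dual_map d).
Proof. by move=> a x y; apply: linear_eq. Qed.
HB.instance Definition _ U V (d : {linear U -> V}) :=
  GRing.isLinear.Build R _ _ _ (dual_map d) (dual_map_is_linear d).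

Definition presents_transpose X T P1 P0 (d : {linear P1 -> P0})
    (e : {linear P0 -> X}) (q : {linear dual P1 -> T}) : Prop :=
  [/\ projective P1, projective P0, exact_at d e /\ surj e
    & exact_at (dual_map d) q /\ surj q].

Hypothesis noethR : noetherian R.

Lemma transpose_exists X : exists T, is_transpose X T.
Proof.
have [n0 [K [i [e ie]]]] := syzygy_exists noethR X; have [_ iee es] := ie.
have [n1 [c cs]] := free_cover K.
have hF n := @free_projective R n.
have [T [q qP]] := @fg_cokernel R _ (FgMod (dual_fg (hF n1))) (dual_map (i \o
  c)).
exists T, (free R n1), (free R n0), (i \o c), e, q; split=> //.
split=> // x; rewrite iee; split=> [[y <-]|[y <-]]; last by exists (c y).
by have [z <-] := cs y; exists z.
Qed.

(** [N] is the image of [P0* -> P1*]: a first syzygy of [T], since [P1*] is projective. *)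
Lemma transpose_kernel X T P1 P0 (d : {linear P1 -> P0}) (e : {linear P0 -> X})
    (q : {linear dual P1 -> T}) :
  presents_transpose d e q ->
  exists N (i : {linear N -> dual P1}) (delta : {linear dual P0 -> N}),
    [/\ short_exact i q, surj delta & forall xi, i (delta xi) = dual_map d xi].
Proof.
case=> hP1 _ _ [dq qs].
have [N [i iq]] := @kernel_short_exact _ noethR (FgMod (dual_fg hP1)) _ q qs.
have [ii ie _] := iq.
have [xi|delta deltaP] := @linear_factor_inj _ _ _ _ i (dual_map d) ii.
  by apply/ie/dq; exists xi.
exists N, i, delta; split=> // z.
have /dq[xi xiP] := short_exact0 iq z.
by exists xi; apply: ii; rewrite deltaP.
Qed.

(** * Transposes and cosyzygies *)

Section TransposeStep.
Variables (X T P1 P0 : fgmod R) (d : {linear P1 -> P0}) (e : {linear P0 -> X}).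
Variable q : {linear dual P1 -> T}.
Hypothesis dq : presents_transpose d e q.
Variables (N : fgmod R) (i : {linear N -> dual P1}) (delta : {linear dual P0 ->
  N}).
Hypothesis iq : short_exact i q.
Hypothesis delta_surj : surj delta.
Hypothesis deltaP : forall xi, i (delta xi) = dual_map d xi.

(** Left exactness of duality: [X*] is the kernel of [P0* -> P1*]. *)
Lemma delta_eq0 xi : delta xi = 0 <-> exists phi : dual X, dual_map e phi = xi.
Proof.
have [_ _ [de es] _] := dq; have [ii _ _] := iq.
have E : delta xi = 0 <-> dual_map d xi = 0.
  by rewrite -deltaP; split=> [->|xi0]; [rewrite raddf0|apply: ii;
    rewrite xi0 raddf0].
rewrite E; split=> [xi0|[phi <-]]; last first.
  by apply: linear_eq => x; rewrite /= (proj2 (de _)) ?raddf0 //; exists x.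
have [x|phi phiP] := @linear_factor_surj _ _ _ _ e xi es.
  by case/de=> y <-; rewrite -[LHS]/(dual_map d xi y) xi0.
by exists phi; apply: linear_eq.
Qed.

(** [P0 -> Q -> Z -> 0] presents [Z]. As functionals extend along [j], the image of [Q* -> P0*] is
    that of [X*], the kernel of [delta], so the transpose of this presentation is [N]. *)
Lemma cosyzygy_transpose Q Z (j : {linear X -> Q}) (p : {linear Q -> Z}) :
  short_exact j p -> projective Q -> functionals_extend j -> is_transpose Z N.
Proof.
move=> [ji je ps] hQ jext; have [_ hP0 [_ es] _] := dq.
exists P0, Q, (j \o e), p, delta; split=> //; split=> //.
  move=> w; rewrite je; split=> [[x <-]|[y <-]]; last by exists (e y).
  by have [y <-] := es x; exists y.
move=> xi.
rewrite delta_eq0; split=> [[phi <-]|[f <-]]; last by exists (dual_map j f);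
  apply: linear_eq.
by have [psi psiP] := jext phi; exists psi; apply: linear_eq => y; apply: psiP.
Qed.

(* Ext^1(T, R) is the kernel of X -> X**. *)
Lemma transpose_functionals_extend :
  (forall x : X, (forall phi : dual X, phi x = 0) -> x = 0) ->
  functionals_extend i.
Proof.
move=> tlX phi; have [_ hP0 [de es] _] := dq.
(* By reflexivity [phi delta] is evaluation at some [y]. It vanishes on [X*], so [e y = 0] and
   [y = d z]; evaluation at [z] is the extension. *)
have [y yP] := projective_reflexive (phi \o delta) hP0.
have /de[z zP] : e y = 0.
  apply: tlX => psi; rewrite -[LHS]/(dual_map e psi y) -yP /=.
  by rewrite (proj2 (delta_eq0 _)) ?raddf0 //; exists psi.
exists (evaluation z) => w; have [xi <-] := delta_surj w.
by rewrite deltaP -[RHS]/((phi \o delta) xi) yP -zP.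
Qed.

(** For [x = e y] killed by all functionals, evaluation at [y] descends to [N], extends to [P1*] and
    becomes evaluation at some [z] in [P1]; then [d z = y], whence [x = 0]. *)
Lemma transpose_torsionless : functionals_extend i ->
  forall x : X, (forall phi : dual X, phi x = 0) -> x = 0.
Proof.
move=> iext x x0; have [hP1 hP0 [de es] _] := dq.
have [y yP] := es x; rewrite -yP.
have [xi|eta etaP] := @linear_factor_surj _ _ _ _ delta (evaluation y)
  delta_surj.
  by case/delta_eq0=> phi <-; rewrite /evaluation /= yP.
have [psi psiP] := iext eta.
have [z zP] := projective_reflexive psi hP1.
apply/de; exists z; apply/eqP; rewrite -subr_eq0; apply/eqP.
apply: projective_torsionless => // xi.
rewrite raddfB /=; apply/eqP; rewrite subr_eq0; apply/eqP.
by rewrite -[LHS]/(dual_map d xi z) -zP -deltaP psiP etaP.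
Qed.

End TransposeStep.

End Duality.

(** * Modules of G-dimension zero *)

Section TotallyReflexive.
Variable R : comPzRingType.
Implicit Types (U V W : lmodType R) (X Y Z T K L M N E P Q : fgmod R).
Hypothesis noethR : noetherian R.

Lemma catG_ext_zero X : catG X -> forall n, ext_zero n X.
Proof. by case=> /(catHP noethR). Qed.

(* Generators of X* map X to a free module; the map is injective because
   Ext^1(Tr X, R) = 0, and a syzygy of Tr X is a transpose of its cokernel. *)
Lemma catG_cosyzygy X : catG X ->
  exists Q Z (j : {linear X -> Q}) (p : {linear Q -> Z}),
    [/\ projective Q, short_exact j p & catG Z].
Proof.
move=> GX; have XH := catG_ext_zero GX.
have [_ [T [[P1 [P0 [d [e [q dq]]]]] /(catHP noethR)TH]]] := GX.
have [N [i [delta [iq deltas deltaP]]]] := transpose_kernel noethR dq.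
have [hP1 hP0 [_ es] _] := dq.
have delta0 := delta_eq0 dq iq deltaP.
have [L [l [li le]]] := @fg_kernel _ noethR (FgMod (dual_fg hP0)) _ delta.
have [m [a as_]] := free_cover L.
(* [L] is the kernel of [delta], a copy of [X*]; a free cover of it yields finitely many generators
   [xi] of [X*]. *)
have /choice[xi xiP] : forall k, exists phi : dual X,
    dual_map e phi = l (a (delta_mx 0 k)).
  by move=> k; apply/delta0/le; exists (a (delta_mx 0 k)).
pose j : {linear X -> free R m} := lrow xi.
have generate (phi : dual X) : exists v : 'rV_m, forall x,
  phi x = \sum_k v 0 k * xi k x.
  have /le[t tP] : delta (dual_map e phi) = 0 by apply/delta0; exists phi.
  have [v vP] := as_ t; exists v => x; have [y <-] := es x.
  rewrite -[LHS]/(dual_map e phi y) -tP -vP (linear_row a) !linear_lcomb.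
  rewrite sum_linearE; apply: eq_bigr => k _.
  by rewrite -[xi k _]/(dual_map e (xi k) y) xiP.
have ji : injective j.
  apply: linear_inj => x x0.
  apply: (transpose_torsionless dq iq deltas deltaP);
    first exact: (TH 0%N _ (FgMod (dual_fg hP1)) _ _ iq).
  move=> phi; have [v ->] := generate phi; apply: big1 => k _.
  have := congr1 (fun w : 'rV_m => w 0 k) x0.
  by rewrite /= !mxE => ->; rewrite mulr0.
have [Z [p [pe ps]]] := fg_cokernel j.
have jp : short_exact j p by [].
have jext : functionals_extend j.
  move=> phi; have [v vP] := generate phi.
  exists (lcomb (fun k => v 0 k : R^o)) => x; rewrite vP.
  by apply: eq_bigr => k _; rewrite mxE; apply: mulrC.
exists (free R m), Z, j, p; split=> //; first exact: free_projective.
have hF := @free_projective R m.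
split.
  (* [Ext^1(Z, R) = 0] because functionals extend along [j]; the higher groups are shifted from
     those of [X]. *)
  apply/(catHP noethR) => -[|n]; last first.
    by apply: (ext_zero_cokernel noethR jp) => //; apply: ext_zero_projective.
  by apply: (ext_zero_cokernel0 noethR jp) => //; apply: ext_zero_projective.
exists N; split; first exact: (cosyzygy_transpose dq iq deltas deltaP jp).
apply/(catHP noethR) => n.
apply: (@ext_zero_kernel _ noethR _ _ (FgMod (dual_fg hP1)) _ _ _ iq) => //.
exact/ext_zero_projective/dual_projective.
Qed.

(* Conversely, cosyzygies in D dimension-shift Ext^{n+1}(Tr X, R) down to n = 0,
   where it vanishes because X embeds in a projective module. *)
Lemma catG_coind (D : fgmod R -> Prop) :
  (forall X, D X -> (forall n, ext_zero n X) /\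
    exists Q Z (j : {linear X -> Q}) (p : {linear Q -> Z}),
      [/\ projective Q, short_exact j p & D Z]) ->
  forall X, D X -> catG X.
Proof.
move=> DP; suff trD n X T : D X -> is_transpose X T -> ext_zero n T.
  move=> X DX; split; first by apply/(catHP noethR) => n; case: (DP X DX).
  have [T TX] := transpose_exists noethR X; exists T; split=> //.
  by apply/(catHP noethR) => n; apply: trD TX.
elim: n X T => [|n IHn] X T DX [P1 [P0 [d [e [q dq]]]]].
all: have [_ [Q [Z [j [p [hQ jp DZ]]]]]] := DP X DX.
all: have [N [i [delta [iq deltas deltaP]]]] := transpose_kernel noethR dq.
all: have [hP1 _ _ _] := dq.
  apply: (@ext_zero_cokernel0 _ noethR _ (FgMod (dual_fg hP1)) _ _ _ iq);
    last first.
    exact/ext_zero_projective/dual_projective.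
  apply: (transpose_functionals_extend dq iq deltas deltaP) => x x0.
  have [ji _ _] := jp; apply: ji; rewrite raddf0.
  by apply: projective_torsionless => // xi; apply: (x0 (dual_map j xi)).
(* [N] is both a syzygy of [T] and a transpose of [Z], which moves the claim to [Z] one degree
   lower. *)
apply: (@ext_zero_cokernel _ noethR _ _ (FgMod (dual_fg hP1)) _ _ _ iq);
  last first.
  exact/ext_zero_projective/dual_projective.
apply: (IHn Z) => //; apply: (cosyzygy_transpose dq iq deltas deltaP jp hQ).
by apply: (proj1 (DP Z DZ) 0%N) jp.
Qed.

(** Adjoining [X] to [catG] gives a class to which the coinduction principle applies. *)
Lemma catG_of_cosyzygy X Q Z (j : {linear X -> Q}) (p : {linear Q -> Z}) :
  (forall n, ext_zero n X) -> projective Q -> short_exact j p -> catG Z ->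
    catG X.
Proof.
move=> XH hQ jp GZ.
apply: (@catG_coind (fun Y => Y = X \/ catG Y)); last by left.
move=> Y [->|GY]; first by split=> //; exists Q, Z, j, p; split=> //; right.
split; first exact: catG_ext_zero.
have [Q' [Z' [j' [p' [hQ' jp' GZ']]]]] := catG_cosyzygy GY.
by exists Q', Z', j', p'; split=> //; right.
Qed.

Lemma catG_projective P : projective P -> catG P.
Proof.
move: P; apply: catG_coind => P hP; split; first by move=> n;
  apply: ext_zero_projective.
exists P, (free R 0), idfun, \0; split=> //; last exact: free_projective.
split=> [x y //|x|y]; first by split=> // _; exists x.
by exists 0; rewrite /= [RHS]thinmx0.
Qed.

(** A horseshoe for cosyzygies: [Y] embeds in [Q + Q'] with a cokernel that is an extension of [Z1]
    by [X1], so the class of all such extensions is closed under cosyzygies. *)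
Lemma catG_extension : extension_closed (@catG R).
Proof.
move=> X Y Z f g fg GX GZ.
apply: (@catG_coind (fun Y => exists X Z (f : {linear X ->
  Y}) (g : {linear Y -> Z}),
  [/\ short_exact f g, catG X & catG Z])); last by exists X, Z, f, g.
move=> {X Z f g fg GX GZ} {}Y [X [Z [f [g [fg GX GZ]]]]]; split=> [n|].
  by apply: (ext_zero_extension noethR fg); apply: catG_ext_zero.
have [Q [X1 [j [q [hQ jq GX1]]]]] := catG_cosyzygy GX.
have [Q' [Z1 [k [q' [hQ' kq GZ1]]]]] := catG_cosyzygy GZ.
have [fi fe gs] := fg; have [ji je qs] := jq; have [ki ke qs'] := kq.
(* The map [j] extends to [h] on [Y] because [Ext^1(Z, R) = 0] and [Q] is projective. *)
have [h hP] := maps_extend j (catG_ext_zero GZ 0 _ _ _ _ fg) hQ.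
pose m : {linear Y -> dsum Q Q'} := lpair h (k \o g).
have mE y : m y = (h y, k (g y)) by [].
have [W [w [we ws]]] := fg_cokernel m.
have [u u0|al alP] := @linear_factor_surj _ _ _ _ q (w \o lpair idfun \0 :
  {linear Q -> W}) qs.
  apply/we; have /je[x <-] := u0; exists (f x).
  by rewrite mE hP (short_exact0 fg) raddf0.
have [[u u'] /= u0|be beP] := @linear_factor_surj _ _ _ _ w (q' \o snd) ws.
  by have /we[y [_ <-]] := u0; rewrite (short_exact0 kq).
exists (dsum Q Q'), W, m, w; split; first exact: projective_prod.
  split=> //; apply: linear_inj => y [hy kgy].
  have /fe[x xy] : g y = 0 by apply: ki; rewrite kgy raddf0.
  by apply/eqP; rewrite -xy; apply/eqP; suff -> : x = 0;
    [exact: raddf0|apply: ji; rewrite -hP xy hy raddf0].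
exists X1, Z1, al, be; split=> //; split.
- apply: linear_inj => x1; have [u <-] := qs x1; rewrite alP.
  case/we=> y; rewrite mE => -[hy kgy].
  have /fe[x xy] : g y = 0 by apply: ki; rewrite kgy raddf0.
  by apply/je; exists x; rewrite -hP xy.
- move=> v; have [[u u'] <-] := ws v; rewrite beP /=; split; last first.
    case=> x1; have [u1 <-] := qs x1; rewrite alP => e.
    by rewrite -[q' u']/((q' \o snd) (u, u')) -beP -e beP /= raddf0.
  case/ke=> z; have [y <-] := gs z => ky; exists (q (u - h y)); rewrite alP.
  apply/eqP; rewrite -subr_eq0 /= -linearB; apply/eqP/we; exists (- y).
  rewrite linearN mE -ky; congr pair; rewrite /= ?sub0r //.
  by rewrite addrAC subrr sub0r.
move=> z1; have [u' <-] := qs' z1; exists (w (0, u')); exact: beP.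
Qed.

(** Composing with the embedding of [Y] embeds [X] in a projective [Q]; the cokernel [W] is an
    extension of [Y1] by [Z], hence in [catG]. *)
Lemma catG_kernel : closed_under_kernels_of_epimorphisms (@catG R).
Proof.
move=> X Y Z f g fg GY GZ; have [fi fe gs] := fg.
have [Q [Y1 [j [q [hQ jq GY1]]]]] := catG_cosyzygy GY; have [ji je qs] := jq.
have [W [w [we ws]]] := fg_cokernel (j \o f).
have XH n : ext_zero n X.
  by apply: (ext_zero_kernel noethR fg); apply: catG_ext_zero.
apply: (catG_of_cosyzygy (j := j \o f) (p := w) XH hQ).
  by split=> // x y /ji/fi.
have [y /fe[x <-]|al alP] := @linear_factor_surj _ _ _ _ g (w \o j) gs.
  by apply/we; exists x.
have [u /we[x <-]|be beP] := @linear_factor_surj _ _ _ _ w q ws.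
  exact: (short_exact0 jq).
apply: (@catG_extension Z W Y1 al be) => //; split.
- apply: linear_inj => z; have [y <-] := gs z; rewrite alP => /we[x xy].
  by rewrite -(ji _ _ xy) (short_exact0 fg).
- move=> v; have [u <-] := ws v; rewrite beP je; split=> [[y <-]|[z]].
    by exists (g y); rewrite alP.
  have [y <-] := gs z; rewrite alP => /eqP; rewrite eq_sym -subr_eq0 -raddfB.
  by case/eqP/we=> x xy; exists (f x + y);
    rewrite linearD -[j (f x)]/((j \o f) x) xy subrK.
by move=> y1; have [u <-] := qs y1; exists (w u).
Qed.

Lemma dsum_short_exact X Y : @short_exact R X (dsum X Y) Y
  (lpair idfun \0 : {linear X -> dsum X Y}) (snd : {linear dsum X Y -> Y}).
Proof.
split=> [x y [] //|[x y]|y] /=; last by exists (0, y).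
by split=> [->|[z [_ <-]] //]; exists x.
Qed.

(* Eilenberg swindle: the cokernel W of X -> Q need not lie in catG at once, but
   W + X does, being an extension of Y1 by Y. *)
Lemma catG_retract X Y (s : {linear X -> Y}) (r : {linear Y -> X}) :
  (forall x, r (s x) = x) -> catG Y -> catG X.
Proof.
move=> rs GY.
apply: (@catG_coind (fun X => exists Y (s : {linear X -> Y}) (r : {linear Y ->
  X}),
  (forall x, r (s x) = x) /\ catG Y)); last by exists Y, s, r.
move=> {Y s r rs GY} {}X [Y [s [r [rs GY]]]]; split=> [n|].
  by apply: ext_zero_retract rs _ => //; apply: catG_ext_zero.
have [Q [Y1 [j [q [hQ jq GY1]]]]] := catG_cosyzygy GY; have [ji je qs] := jq.
have [W [w [we ws]]] := fg_cokernel (j \o s).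
exists Q, W, (j \o s), w; split=> //.
  by split=> // x y /ji/(congr1 r); rewrite !rs.
exists (dsum W X), (lpair idfun \0), fst; split=> //.
have [u /we[x <-]|be beP] := @linear_factor_surj _ _ _ _ w q ws.
  exact: (short_exact0 jq).
apply: (@catG_extension Y (dsum W X) Y1 (lpair (w \o j) r) (be \o fst)) => //;
  split.
- apply: linear_inj => y [/we[x xy] ry].
  by move: ry; rewrite -(ji _ _ xy) rs => ->; rewrite raddf0.
- case=> v x; have [u <-] := ws v; rewrite /= beP je;
  split=> [[y <-]|[y [yu _]]].
    (* Adding [s t] to [y] changes [r y] by [t] and leaves the class in [W] alone, since [w] kills
       the image of [j s]. *)
    have [t tE] : exists t, t = x - r y by exists (x - r y).
    have t0 : w (j (s t)) = 0 by apply/we; exists t.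
    exists (y + s t); rewrite /lpair /=; congr pair.
      by rewrite !linearD /= t0 addr0.
    by rewrite linearD /= rs tE addrC subrK.
  move/eqP: yu; rewrite eq_sym -subr_eq0 -raddfB => /eqP/we[x' x'P].
  by exists (s x' + y); rewrite linearD -[j (s x')]/((j \o s) x') x'P subrK.
by move=> y1; have [u <-] := qs y1; exists (w u, 0); apply: beP.
Qed.

Lemma catG_subcategory : subcategory (@catG R).
Proof.
split=> [X Y [f [g [_ fg]]]|X Y|P].
- apply: (@catG_retract Y X g f) => x.
  exact: (congr1 (fun h : {linear Y -> Y} => h x) fg).
- split=> [G2|[GX GY]]; last exact: catG_extension (dsum_short_exact X Y) GX GY.
  split.
    by apply: (@catG_retract X (dsum X Y) (lpair idfun \0) fst).
  by apply: (@catG_retract Y (dsum X Y) (lpair \0 idfun) snd).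
exact: catG_projective.
Qed.

(** The module [X] is literally a syzygy of its cosyzygy, so the stable isomorphism is the
    identity. *)
Lemma catG_syzygy_surjective : syzygy_surjective (@catG R).
Proof.
move=> X; have [Q [Z [j [p [hQ jp GZ]]]]] := catG_cosyzygy (svalP X).
exists (exist _ Z GZ), X; split; first by exists Q, j, p.
by exists (@idm (stable (@catG R)) X), (@idm (stable (@catG R)) X); split;
  apply: comp_idl.
Qed.

End TotallyReflexive.

(** * The stable category *)

Section StableMaps.
Variable R : comPzRingType.
Implicit Types (U V W : lmodType R) (X Y Z T K L M N E P Q : fgmod R).

Lemma stable_class_eq0 U V (f : {linear U -> V}) :
  stable_class f = 0 <-> factors_through_projective f.
Proof.
have z0 : stable_class (0 : {linear U -> V}) = 0.
  exact: (raddf0 \pi_(Quotient.quot (@proj_maps R U V))).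
rewrite -z0 stable_classP.
suff -> : f - 0 = f by [].
by apply: linear_eq => x /=; rewrite subr0.
Qed.

(** Lifting along a free cover of [Y] replaces the projective module by a finite free one, to which
    [maps_extend] applies. *)
Lemma factors_through_free U Y (f : {linear U -> Y}) :
  factors_through_projective f ->
  exists n (a : {linear U -> free R n}) (b : {linear free R n -> Y}),
    forall x, f x = b (a x).
Proof.
move=> [P [a [b [hP fE]]]]; have [n [c cs]] := free_cover Y.
have [b' b'P] := hP _ _ c b cs.
by exists n, (b' \o a), c => x; rewrite fE /= b'P.
Qed.

(** Subtracting a map through [P] turns [p t] into zero, and the corrected map factors through
    [i]. *)
Lemma stable_lift U V W T (i : {linear U -> V}) (p : {linear V -> W})
    (t : {linear T -> V}) :
  short_exact i p -> factors_through_projective (p \o t : {linear T -> W}) ->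
  exists s : {linear T ->
    U}, factors_through_projective (t - (i \o s : {linear T -> V})).
Proof.
move=> [ii ie ps] [P [a [b [hP ptE]]]]; have [b' b'P] := hP _ _ p b ps.
have [x|s sP] := @linear_factor_inj _ _ _ _ i (t \- (b' \o a)) ii.
  by apply/ie; rewrite raddfB /= b'P -ptE subrr.
exists s, P, a, b'; split=> // x.
by rewrite /= sP /= opprB addrC subrK.
Qed.

End StableMaps.

(** * Weak kernels in the stable category *)

Section StableCategory.
Variable R : comPzRingType.
Hypothesis noethR : noetherian R.
Variable C : fgmod R -> Prop.
Hypotheses (subC : subcategory C) (resC : resolving C).
Hypotheses (CH : forall X, C X -> catH X) (omegaC : syzygy_surjective C).
Implicit Types X Y Z T : stable C.

Local Notation "[ 'st' f ]" := (stable_class f) (format "[ 'st'  f ]").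

Lemma stable_pcompE X Y Z (g : {linear sval Y -> sval Z})
    (f : {linear sval X -> sval Y}) :
  @pcomp (stable C) X Y Z [st g] [st f] = [st g \o f].
Proof. exact: stable_compE. Qed.

Lemma stable_zero : exists Z : stable C, pidm Z = 0.
Proof.
have [_ _ Cproj] := subC; have hF := @free_projective R 0.
exists (exist _ (free R 0) (Cproj _ hF)); apply/stable_class_eq0.
by exists (free R 0), idfun, idfun.
Qed.

Lemma stable_biproducts X Y :
  exists S (i1 : phom X S) (i2 : phom Y S) (p1 : phom S X) (p2 : phom S Y),
    is_biproduct i1 i2 p1 p2.
Proof.
have [_ Csum _] := subC.
have CS := proj2 (Csum (sval X) (sval Y)) (conj (svalP X) (svalP Y)).
pose S : stable C := exist _ _ CS.
pose i1 : {linear sval X -> dsum (sval X) (sval Y)} := lpair idfun \0.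
pose i2 : {linear sval Y -> dsum (sval X) (sval Y)} := lpair \0 idfun.
pose p1 : {linear dsum (sval X) (sval Y) -> sval X} := fst.
pose p2 : {linear dsum (sval X) (sval Y) -> sval Y} := snd.
have z0 (X' Y' : stable C) : [st 0 : {linear sval X' ->
  sval Y'}] = 0 :> phom X' Y'.
  exact: (raddf0 \pi_(Quotient.quot (@proj_maps R _ _))).
exists S, [st i1], [st i2], [st p1], [st p2].
split; rewrite ?(@stable_pcompE X S) ?(@stable_pcompE Y S) ?(@stable_pcompE S X)
  ?(@stable_pcompE S Y) -?z0 -?stable_classD; congr stable_class.
1-4: exact: linear_eq.
by apply: linear_eq => -[x y]; congr pair; rewrite /= ?addr0 ?add0r.
Qed.

Lemma stable_weak_kernels X Y (f : phom X Y) :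
  exists K (k : phom K X), weak_kernel k f /\ weak_cokernel f k.
Proof.
have [_ Csum Cproj] := subC; have [Cker _] := resC.
have [f' <-] := stable_surj f => {f}.
have [n [c cs]] := free_cover (sval Y); have hF := @free_projective R n.
pose E := dsum (sval X) (free R n).
pose p : {linear E -> sval Y} := (f' \o fst) \+ (c \o snd).
have ps : surj p.
  by move=> y; have [v vP] := cs y; exists (0, v); rewrite /= raddf0 add0r.
have [K [i ip]] := kernel_short_exact noethR ps.
have CK : C K.
  apply: Cker ip _ (svalP Y); apply/Csum; split; [exact: svalP | exact: Cproj].
(* On [K] the map [f'] equals [-c] after the second projection, so [f' k] factors through a free
   module. *)
have pi0 x : f' (i x).1 = - c (i x).2.
  by apply/eqP; rewrite -addr_eq0; apply/eqP; apply: (short_exact0 ip x).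
pose k : {linear K -> sval X} := fst \o i.
exists (exist _ K CK : stable C), [st k]; split=> T t;
  have [t' <-] := stable_surj t => {t}.
  rewrite (@stable_pcompE T X Y); split=> [/stable_class_eq0 ft|[s]].
    have [|s [P [a [b [hP sP]]]]] :=
      @stable_lift _ _ _ _ _ i p (lpair t' \0 : {linear sval T -> E}) ip.
      have [P [a [b [hP ftE]]]] := ft; exists P, a, b; split=> // x.
      by rewrite /= raddf0 addr0 -ftE.
    exists [st s]; rewrite (@stable_pcompE T (exist _ K CK) X).
    apply/esym/stable_classP; exists P, a, (fst \o b); split=> // x.
    have /(congr1 fst) := sP x; exact.
  have [s' <-] := stable_surj s; rewrite (@stable_pcompE T (exist _ K CK) X).
  move=> e; rewrite -(@stable_pcompE T X Y) -e (@stable_pcompE T X Y).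
  apply/stable_class_eq0; exists (free R n), (snd \o i \o s'), (\- c);
    split=> // x.
  by rewrite /= pi0.
rewrite (@stable_pcompE (exist _ K CK) X T); split=> [/stable_class_eq0|[s]].
  case/factors_through_free=> m [a [b tE]].
  (* [Ext^1(Y, R) = 0] extends [a] to [a'] on the whole of [E], so that [t' - b a'] vanishes on [K]
     and descends to [v] on [Y]. *)
  have iext : functionals_extend i.
    exact: (proj1 (catHP noethR _) (CH (svalP Y)) 0%N _ _ _ _ ip).
  have [a' a'P] := maps_extend a iext (@free_projective R m).
  have [_ ie _] := ip.
  have [e /ie[x <-]|v vP] :=
    @linear_factor_surj _ _ _ _ p ((t' \o fst) \- (b \o a')) ps.
    by rewrite /= a'P -tE subrr.
  exists [st v]; rewrite (@stable_pcompE X Y T); apply/esym/stable_classP.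
  exists (free R m), (a' \o lpair idfun \0), b; split=> [|x];
    first exact: free_projective.
  have := vP (x, 0); rewrite /= raddf0 addr0 => ->.
  by rewrite opprB addrC subrK.
have [s' <-] := stable_surj s; rewrite (@stable_pcompE X Y T) => e.
rewrite -(@stable_pcompE (exist _ K CK) X T) -e (@stable_pcompE (exist _ K CK)
  X T).
apply/stable_class_eq0; exists (free R n), (snd \o i), (\- (s' \o c));
  split=> // x.
by rewrite /= pi0 raddfN.
Qed.

Lemma stable_weak_kernel_of X Y (f : phom X Y) :
  exists Z (g : phom Y Z), weak_kernel f g.
Proof.
have [_ Cext] := resC.
(* [X] is replaced by the stably isomorphic [Z'], which embeds by [j] in a projective [P] with
   cokernel [Y'] in [C]. *)
have [Y' [Z' [[P [j [q [hP jq]]]] [u [w [_ uw]]]]]] := omegaC X.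
have [f1 f1E] := stable_surj (pcomp f u); have [ji je qs] := jq.
pose m : {linear sval Z' -> dsum (sval Y) P} := lpair f1 j.
have mE x : m x = (f1 x, j x) by [].
have [W [c [ce cs]]] := fg_cokernel m.
have mc : short_exact m c.
  by split=> //; apply: linear_inj => x [_ jx]; apply: ji; rewrite jx raddf0.
pose a : {linear sval Y -> W} := c \o lpair idfun \0.
have aE y : a y = c (y, 0) by [].
have [z /ce[x <-]|b bP] := @linear_factor_surj _ _ _ _ c (q \o snd) cs.
  exact: (short_exact0 jq).
have bE y z : b (c (y, z)) = q z by apply: bP.
(* Up to sign, [W] is the pushout of [f1] and [j], hence an extension of [Y'] by [Y]. *)
have CW : C W.
  apply: (Cext _ _ _ a b) (svalP Y) (svalP Y'); split.
  - apply: linear_inj => y; rewrite aE => /ce[x [<- jx]].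
    by have -> : x = 0; [apply: ji; rewrite jx raddf0 | rewrite raddf0].
  - move=> v; have [[y z] <-] := cs v; rewrite bE; split=> [/je[x xz]|[y']].
      exists (y - f1 x); rewrite aE; apply/eqP; rewrite -subr_eq0 -linearB.
      apply/eqP/ce; exists (- x); rewrite linearN mE -xz.
      by congr pair; rewrite /= ?sub0r // addrAC subrr sub0r.
    by rewrite -(bE y) => <-; rewrite aE bE raddf0.
  by move=> y; have [z <-] := qs y; exists (c (0, z)); apply: bP.
exists (exist _ W CW : stable C), [st a] => T t; split=> [|[s <-]].
  have [t' <-] := stable_surj t => {t}.
  rewrite (@stable_pcompE T Y (exist _ W CW)) => /stable_class_eq0 at0.
  (* The pair [(t', 0)] lifts stably through [m]; the first component of the lift factors [t]
     through [f1]. *)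
  have [|s [Q [d [e [hQ sP]]]]] :=
    @stable_lift _ _ _ _ _ m c (lpair t' \0 : {linear sval T ->
      dsum (sval Y) P}) mc.
    have [Q [d [e [hQ atE]]]] := at0; exists Q, d, e; split=> // x; exact: atE.
  exists (pcomp u [st s]); rewrite pcompA -f1E (@stable_pcompE T Z' Y).
  apply/esym/stable_classP; exists Q, d, (fst \o e); split=> // x.
  have /(congr1 fst) := sP x; exact.
have -> : pcomp f s = pcomp ([st f1] : phom Z' Y) (pcomp (w : phom X Z') s).
  rewrite f1E -pcompA (pcompA (u : phom Z' X)).
  by rewrite [pcomp (u : phom Z' X) _]uw pcomp1m.
rewrite pcompA (@stable_pcompE Z' Y (exist _ W CW)).
(* In [W] the classes of [(f1 x, 0)] and [(0, - j x)] agree, so [a f1] factors through [P]. *)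
suff -> : [st a \o f1] = 0 by apply: pcomp0m.
apply/stable_class_eq0; exists P, j, (\- (c \o lpair \0 idfun)); split=> // x.
rewrite /= -linearN; apply/eqP; rewrite -subr_eq0 -linearB; apply/eqP/ce;
  exists x.
by rewrite mE; congr pair; rewrite /= opprK ?addr0 ?add0r.
Qed.

Theorem frobenius_modf_stable : frobenius (modf (stable C)).
Proof.
apply: frobenius_modf.
- exact: stable_zero.
- exact: stable_biproducts.
- exact: stable_weak_kernels.
exact: stable_weak_kernel_of.
Qed.

End StableCategory.

Theorem theorem3p7 (R : comPzRingType) (noethR : noetherian R) :
  (forall C : fgmod R -> Prop,
      subcategory C ->
      resolving C ->
      (forall X, C X -> catH X) ->
      syzygy_surjective C ->
      frobenius (modf (stable C))) /\
  frobenius (modf (stable (@catG R))).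
Proof.
split=> [C subC resC CH omegaC|]; first exact: frobenius_modf_stable.
apply: frobenius_modf_stable => //.
- exact: catG_subcategory.
- by split; [apply: catG_kernel | apply: catG_extension].
- by move=> X [].
exact: catG_syzygy_surjective.
Qed.
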